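(* Let $\mathbb{K}$ be an algebraically closed field and let $P(x,y,T):=p(x,y)-T x^cU(x,y)$ be a special pencil over $\mathbb{K}[[x,y]]$, with associated meromorphic germ $r=\frac{p}{x^cU}$. Then for each dicritical divisor $E$ of $r$ the function $\pi^*(r)|_E$ is a polynomial; that is, there is an affine coordinate $z$ on $E\cong\mathbb{P}^1_{\mathbb{K}}$ in which $\pi^*(r)|_E:E\to\mathbb{P}^1_{\mathbb{K}}$ is given by a polynomial in $\mathbb{K}[z]$.
   Context: $R=\mathbb{K}[[x,y]]$ (any characteristic). A special pencil is given by $r=\frac{p(x,y)}{x^cU(x,y)}$ with $c>0$ an integer, $U\in R$ a unit, $p$ in the maximal ideal of $R$ and $x\nmid p$; $T$ is an indeterminate. Let $\pi:S\to\mathrm{Spec}\,R$ be a composition of blow-ups of closed points, starting with the closed point $0$ and always over it, such that $\pi^*(r):S\to\mathbb{P}^1_{\mathbb{K}}$ is a well-defined morphism. An irreducible component $E$ of $\pi^{-1}(0)$ is a dicritical divisor if $\pi^*(r)|_E$ is not constant. *)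

(* Defs.v *)
From HB Require Import structures.
From mathcomp Require Import all_boot all_order all_algebra.
From mathcomp Require Import all_classical.
Set Implicit Arguments.
Unset Strict Implicit.
Unset Printing Implicit Defensive.
Import GRing.Theory.
Local Open Scope classical_set_scope.
Local Open Scope ring_scope.

(* A record, not a plain alias of nat -> A: the latter already carries the
   pointwise ring structure. *)
Record fps (A : Type) := Fps { fcoef : nat -> A }.
Arguments Fps {A}.

HB.instance Definition _ (A : Type) := gen_eqMixin (fps A).
HB.instance Definition _ (A : Type) := gen_choiceMixin (fps A).

Lemma fpsP (A : Type) (f g : fps A) : fcoef f =1 fcoef g -> f = g.
Proof. by case: f g => f [g] /= /funext ->. Qed.

Section FpsRing.
Variable A : comNzRingType.
Implicit Types f g h : fps A.

Definition fps_zero : fps A := Fps (fun=> 0).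
Definition fps_opp f : fps A := Fps (fun n => - fcoef f n).
Definition fps_add f g : fps A := Fps (fun n => fcoef f n + fcoef g n).

Fact fps_addA : associative fps_add.
Proof. by move=> f g h; apply: fpsP => n /=; rewrite addrA. Qed.
Fact fps_addC : commutative fps_add.
Proof. by move=> f g; apply: fpsP => n /=; rewrite addrC. Qed.
Fact fps_add0 : left_id fps_zero fps_add.
Proof. by move=> f; apply: fpsP => n /=; rewrite add0r. Qed.
Fact fps_addN : left_inverse fps_zero fps_opp fps_add.
Proof. by move=> f; apply: fpsP => n /=; rewrite addNr. Qed.

HB.instance Definition _ :=
  GRing.isZmodule.Build (fps A) fps_addA fps_addC fps_add0 fps_addN.

Definition fpsC (a : A) : fps A := Fps (fun n => if n is 0%N then a else 0).
Definition fpsX : fps A := Fps (fun n => (n == 1%N)%:R).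
Definition fps_mul f g : fps A :=
  Fps (fun n => \sum_(i < n.+1) fcoef f i * fcoef g (n - i)%N).

Let trunc N f : {poly A} := \poly_(i < N) fcoef f i.

Let coef_trunc N f n : (n < N)%N -> (trunc N f)`_n = fcoef f n.
Proof. by move=> nN; rewrite coef_poly nN. Qed.

Let coef_mul N f g n : (n < N)%N ->
  fcoef (fps_mul f g) n = (trunc N f * trunc N g)`_n.
Proof.
move=> nN; rewrite coefM /=; apply: eq_bigr => i _; rewrite !coef_trunc //.
  exact: leq_ltn_trans (leq_subr _ _) nN.
exact: leq_trans (ltn_ord i) nN.
Qed.

Fact fps_mulA : associative fps_mul.
Proof.
move=> f g h; apply: fpsP => n.
transitivity (trunc n.+1 f * (trunc n.+1 g * trunc n.+1 h))`_n.
  rewrite coefM; apply: eq_bigr => i _.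
  by rewrite (@coef_mul n.+1) ?ltnS ?leq_subr// coef_trunc.
rewrite mulrA coefM; apply: eq_bigr => i _.
by rewrite (@coef_mul n.+1) ?ltn_ord// coef_trunc// ltnS leq_subr.
Qed.

Fact fps_mulC : commutative fps_mul.
Proof.
by move=> f g; apply: fpsP => n; rewrite !(@coef_mul n.+1)// mulrC.
Qed.

Fact fps_mul1 : left_id (fpsC 1) fps_mul.
Proof.
move=> f; apply: fpsP => n /=; rewrite big_ord_recl /= mul1r subn0.
by rewrite big1 ?addr0// => i _; rewrite mul0r.
Qed.

Fact fps_mulDl : left_distributive fps_mul fps_add.
Proof.
move=> f g h; apply: fpsP => n /=; rewrite -big_split /=.
by apply: eq_bigr => i _; rewrite mulrDl.
Qed.

Fact fps_1neq0 : fpsC 1 != 0.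
Proof.
apply/eqP => /(congr1 (fun f => fcoef f 0)) /= /eqP.
by rewrite (negPf (oner_neq0 A)).
Qed.

HB.instance Definition _ := GRing.Zmodule_isComNzRing.Build (fps A)
  fps_mulA fps_mulC fps_mul1 fps_mulDl fps_1neq0.

Definition fps_unit : {pred fps A} := fun f => `[< exists g, g * f = 1 >].
Definition fps_inv f : fps A :=
  if pselect (exists g, g * f = 1) is left e then projT1 (cid e) else f.

Fact fps_mulV : {in fps_unit, left_inverse 1 fps_inv *%R}.
Proof.
move=> f /asboolP ef; rewrite /fps_inv; case: pselect => // e.
by case: (cid e).
Qed.

Fact fps_unitP f g : g * f = 1 -> fps_unit f.
Proof. by move=> gf; apply/asboolP; exists g. Qed.

Fact fps_inv_out : {in [predC fps_unit], fps_inv =1 id}.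
Proof. by move=> f /asboolPn nf; rewrite /fps_inv; case: pselect. Qed.

HB.instance Definition _ := GRing.ComNzRing_hasMulInverse.Build (fps A)
  fps_mulV fps_unitP fps_inv_out.

Fact fpsC_is_zmod_morphism : zmod_morphism fpsC.
Proof. by move=> a b; apply: fpsP => -[|n] //=; rewrite subr0. Qed.

Fact fpsC_is_monoid_morphism : monoid_morphism fpsC.
Proof.
split=> // a b; apply: fpsP => n /=; rewrite big_ord_recl /= subn0.
rewrite big1 => [|i _]; last by rewrite mul0r.
by case: n => [|n]; rewrite /= addr0 ?mulr0.
Qed.

HB.instance Definition _ :=
  GRing.isZmodMorphism.Build A (fps A) fpsC fpsC_is_zmod_morphism.
HB.instance Definition _ :=
  GRing.isMonoidMorphism.Build A (fps A) fpsC fpsC_is_monoid_morphism.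

End FpsRing.

Arguments fpsX {A}.

Section FpsDomain.
Variable A : idomainType.

Let fps_order (f : fps A) : f != 0 ->
  exists n, fcoef f n != 0 /\ forall i, (i < n)%N -> fcoef f i = 0.
Proof.
move=> f0; have ex : exists n, fcoef f n != 0.
  apply: contrapT => /forallNP nf; case/eqP: f0; apply: fpsP => n /=.
  by apply/eqP; apply: contrapT => /negP; apply: nf.
case: (ex_minnP ex) => n fn nmin; exists n; split=> // i lin.
by apply/eqP; apply: contraLR lin => /nmin; rewrite -leqNgt.
Qed.

Fact fps_idomain : GRing.integral_domain_axiom (fps A).
Proof.
move=> f g fg0; apply/norP => -[/fps_order [a [fa fl]] /fps_order [b [gb gl]]].
have := congr1 (fun h => fcoef h (a + b)%N) fg0; rewrite /= => /eqP.
have ha : (a < (a + b).+1)%N by rewrite ltnS leq_addr.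
rewrite (bigD1 (Ordinal ha)) //= addKn big1 ?addr0 => [|i neq].
  by rewrite mulf_eq0 (negPf fa) (negPf gb).
have [ltia|] := ltnP i a; first by rewrite fl // mul0r.
rewrite leq_eqVlt => /orP[/eqP eai|lai].
  by case/eqP: neq; apply/val_inj/esym.
have iab : (i <= a + b)%N by rewrite -ltnS.
by rewrite gl ?mulr0 // ltn_subLR // ltn_add2r.
Qed.

HB.instance Definition _ :=
  GRing.ComUnitRing_isIntegral.Build (fps A) fps_idomain.

End FpsDomain.

(* K[[x,y]] = K[[x]][[y]], x being the inner variable, and its fraction field. *)
Notation "{ 'psxy' K }" := (fps (fps K)) (format "{ 'psxy'  K }") : type_scope.
Notation "{ 'fracxy' K }" := ({fraction {psxy K}})
  (format "{ 'fracxy'  K }") : type_scope.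

Definition psx (K : fieldType) : {psxy K} := fpsC fpsX.

Definition kconst (K : fieldType) : K -> {fracxy K} :=
  @FracField.tofrac {psxy K} \o (@fpsC (fps K) \o @fpsC K).
HB.instance Definition _ (K : fieldType) :=
  GRing.RMorphism.on (@kconst K).

(* An integral separated scheme with function field F is encoded, following
   Zariski, by the set of its local rings, which are subrings of F. A point s
   is thus the set B = O_s, and s' is a specialization of s iff O_s' is
   contained in O_s. *)

Section Models.
Variable F : fieldType.
Implicit Types (A B V W : set F) (S : set (set F)).

Definition subring B :=
  [/\ B 1, forall a b, B a -> B b -> B (a - b)
         & forall a b, B a -> B b -> B (a * b)].

Definition prime_ideal B (q : set F) :=
  [/\ q `<=` B /\ q 0, forall a b, q a -> q b -> q (a + b),
      forall a b, B a -> q b -> q (a * b), ~ q 1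
    & forall a b, B a -> B b -> q (a * b) -> q a \/ q b].

Definition localization B (q : set F) : set F :=
  [set a / b | a in B & b in B `\` q].

Definition spec B : set (set F) := [set localization B q | q in prime_ideal B].

(* The non-units of B: the maximal ideal when B is local. *)
Definition maxid B : set F := [set a | B a /\ ~ exists b, B b /\ a * b = 1].

Definition dominates B A := A `<=` B /\ maxid A `<=` maxid B.

(* The coordinate ring A[m/u] of the chart D_+(u) of the blow-up
   Proj (A + m + m^2 + ...) of Spec A at its closed point, m = maxid A. *)
Definition blowup_chart A (u : F) : set F :=
  smallest subring (A `|` [set w / u | w in maxid A]).

Definition exceptional_points A : set (set F) :=
  [set B | exists u, [/\ maxid A u, u != 0,
                         spec (blowup_chart A u) B & dominates B A]].

(* The blow-up of the model S at its closed point A is an isomorphism away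
   from A, and A is replaced by the points lying over it. *)
Definition blowup S A : set (set F) := (S `\ A) `|` exceptional_points A.

Definition closed_point S A := S A /\ forall B, S B -> B `<=` A -> B = A.

(* For R local: models obtained from Spec R by blowing up its closed point,
   then finitely many closed points lying over it. *)
Inductive blowup_tower (R : set F) : set (set F) -> Prop :=
| tower_first : blowup_tower R (blowup (spec R) R)
| tower_next S A : blowup_tower R S -> closed_point S A -> dominates A R ->
    blowup_tower R (blowup S A).

(* r extends to a morphism from S to P^1. *)
Definition morphism_to_P1 S (r : F) := forall B, S B -> B r \/ B r^-1.

(* V is the generic point of an irreducible component of the fibre of S over
   the closed point of Spec R. *)
Definition fibre_component (R : set F) S V :=
  [/\ S V, dominates V R
    & forall W, S W -> dominates W R -> V `<=` W -> W = V].

(* Let E be the closure of the point V, with its reduced structure. Its function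
   field is the residue field V / maxid V, and subrings of the latter are
   represented by their preimages in V. *)
Definition closure_points S V : set (set F) :=
  [set [set a + m | a in B & m in maxid V] | B in [set B | S B /\ B `<=` V]].

Variables (k : fieldType) (i : {rmorphism k -> F}).

Definition peval (f : {poly k}) (z : F) : F := (map_poly i f).[z].

(* The preimage in V of k[z]. *)
Definition affine_ring V (z : F) : set F :=
  [set peval f z + m | f in [set: {poly k}] & m in maxid V].

(* The points of Spec k[z], as local rings in V / maxid V. *)
Definition affine_line V (z : F) : set (set F) :=
  [set localization (affine_ring V z) q
     | q in [set q | prime_ideal (affine_ring V z) q /\ maxid V `<=` q]].

(* z is an affine coordinate on E: E is the union of the affine lines Spec k[z]
   and Spec k[1/z], where z is transcendental over k. *)
Definition affine_coordinate S V (z : F) :=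
  [/\ V z, forall f : {poly k}, f != 0 -> ~ maxid V (peval f z)
    & closure_points S V = affine_line V z `|` affine_line V z^-1].

(* r is constant on E, with value infinity or a point of k. *)
Definition constant_on V (r : F) :=
  maxid V r^-1 \/ exists a : k, maxid V (r - i a).

End Models.

Section Pencils.
Variable K : fieldType.
Implicit Types (p U : {psxy K}) (S : set (set {fracxy K})).

(* K[[x,y]] as a subring of its fraction field. *)
Definition ringxy : set {fracxy K} := range (@FracField.tofrac {psxy K}).

(* K[[x,y]] is local, so its maximal ideal is the set of non-units. *)
Definition special_pencil p (c : nat) U :=
  [/\ (0 < c)%N, U \is a GRing.unit, p \isn't a GRing.unit
    & ~ exists q, p = psx K * q].

Definition pencil_germ p (c : nat) U : {fracxy K} :=
  FracField.tofrac p / FracField.tofrac (psx K ^+ c * U).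

Definition resolution (r : {fracxy K}) S :=
  blowup_tower ringxy S /\ morphism_to_P1 S r.

Definition dicritical (r : {fracxy K}) S V :=
  fibre_component ringxy S V /\ ~ constant_on (@kconst K) V r.

End Pencils.

(* Main.v *)
(* Every closed point B of a tower is a regular local ring with some parameters
   u, v, and the exceptional curve of the blow-up of B is the projective line
   with coordinate v / u; later blow-ups replace a point of that curve by the
   one point of its strict transform, so its set of points is unchanged up to
   the maximal ideal of its generic point. One follows the shape of r along the
   tower: at each closed point, either r = g / v^n has poles along a single
   branch (at the beginning, the branch x = 0), or r = g / (u^n v^m) with g
   outside the ideal (u^n, v^m). The second shape forces r to have a pole along the new
   exceptional curve, and it persists at the two satellite points. Hence a
   dicritical divisor comes from the first shape, with g of order at least n,
   and there g / v^n is a polynomial in u / v on the exceptional curve. *)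

Require Import Defs.
From mathcomp Require Import all_boot all_order all_algebra.
From mathcomp Require Import all_classical.
From mathcomp Require Import ring.

Set Implicit Arguments.
Unset Strict Implicit.
Unset Printing Implicit Defensive.
Import GRing.Theory.

(** * Localizations *)

Section LocalSubrings.
Local Open Scope classical_set_scope.
Local Open Scope ring_scope.
Variable F : fieldType.
Implicit Types (A B C D V q : set F) (a b x : F).

(** A function on E is a polynomial in some coordinate when it has at most one pole there, so the
    danger is a dicritical curve meeting polar branches in two points, as for (u^2 + v^2) / (u v),
    which restricts to z + 1/z. The condition that g avoids (u^n, v^m) excludes this: the ideal
    contains all monomials of degree n + m, so g has order less than n + m. The condition reproduces
    itself at satellite points because forms of a given degree are independent over k; this is
    derived from the regular sequence u, v alone, so that it is available at every point of the
    tower. The second difficulty is to describe E as a curve in the final model. Points being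
    subrings of F, E is recovered from the rings B + m_V, for B a point on the curve with generic
    point V. Besides the shape of r, the induction therefore carries the smoothness of the curves at
    tame points, the separation of tame points from all others, and the fact that every tame point
    lies on a curve. *)

Lemma subring1 B : subring B -> B 1. Proof. by case. Qed.

Lemma subringB B a b : subring B -> B a -> B b -> B (a - b).
Proof. by case=> _ h _; apply: h. Qed.

Lemma subringM B a b : subring B -> B a -> B b -> B (a * b).
Proof. by case=> _ _; apply. Qed.

Lemma subring0 B : subring B -> B 0.
Proof. by move=> sB; rewrite -(subrr 1); apply: subringB => //; apply: subring1. Qed.

Lemma subringN B a : subring B -> B a -> B (- a).
Proof. by move=> sB Ba; rewrite -sub0r; apply: subringB => //; apply: subring0. Qed.

Lemma subringD B a b : subring B -> B a -> B b -> B (a + b).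
Proof.
by move=> sB Ba Bb; rewrite -(opprK b); apply: subringB => //; apply: subringN.
Qed.

Lemma subringX B a n : subring B -> B a -> B (a ^+ n).
Proof.
move=> sB Ba; elim: n => [|n IH]; first by rewrite expr0; apply: subring1.
by rewrite exprS; apply: subringM.
Qed.

Definition local_ring V :=
  subring V /\ forall a b, maxid V a -> maxid V b -> maxid V (a + b).

Lemma maxidW V a : maxid V a -> V a. Proof. by case. Qed.

Lemma maxidM V a b : subring V -> V a -> maxid V b -> maxid V (a * b).
Proof.
move=> sV Va [Vb nb]; split; first exact: subringM.
by move=> [c [Vc abc]]; apply: nb; exists (a * c); split; [exact: subringM|];
   rewrite -abc; ring.
Qed.

Lemma maxidMr V a b : subring V -> V b -> maxid V a -> maxid V (a * b).
Proof. by move=> *; rewrite mulrC; apply: maxidM. Qed.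

Lemma maxidN V a : subring V -> maxid V a -> maxid V (- a).
Proof.
move=> sV ma; rewrite -mulN1r; apply: maxidM => //.
by apply: subringN => //; apply: subring1.
Qed.

Lemma maxid0 V : subring V -> maxid V 0.
Proof.
move=> sV; split; first exact: subring0.
by move=> [b [_ /eqP]]; rewrite mul0r eq_sym oner_eq0.
Qed.

Lemma maxid1 V : subring V -> ~ maxid V 1.
Proof. by move=> sV [_ []]; exists 1; rewrite mulr1; split=> //; apply: subring1. Qed.

Lemma maxid_inv V a : a != 0 -> V a^-1 -> ~ maxid V a.
Proof. by move=> a0 Va [_ []]; exists a^-1; rewrite mulfV. Qed.

Lemma nmaxid V a : V a -> ~ maxid V a -> a != 0 /\ V a^-1.
Proof.
move=> Va /not_andP[//|/contrapT[b [Vb ab]]].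
have a0 : a != 0 by apply/eqP => a0; move/eqP: ab; rewrite a0 mul0r eq_sym oner_eq0.
by split=> //; rewrite (_ : a^-1 = b) // -[b](mulKf a0) ab mulr1.
Qed.

Lemma maxidB V a b : local_ring V -> maxid V a -> maxid V b -> maxid V (a - b).
Proof. by move=> [sV lV] ma mb; apply: lV => //; apply: maxidN. Qed.

Lemma nmaxidM V a b : subring V -> V a -> V b ->
  ~ maxid V a -> ~ maxid V b -> ~ maxid V (a * b).
Proof.
move=> sV Va Vb /(nmaxid Va)[a0 Via] /(nmaxid Vb)[b0 Vib].
by apply: maxid_inv; [rewrite mulf_neq0|rewrite invfM; apply: subringM].
Qed.

Lemma local_addr_unit V a b : local_ring V ->
  ~ maxid V a -> maxid V b -> ~ maxid V (a + b).
Proof. by move=> lV na mb mab; apply: na; rewrite -(addrK b a); apply: maxidB. Qed.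

Lemma dominates_refl A : dominates A A. Proof. by split. Qed.

Lemma dominates_trans A B C : dominates A B -> dominates B C -> dominates A C.
Proof. by move=> [h1 h2] [h3 h4]; split=> x; [move/h3/h1|move/h4/h2]. Qed.

Section PrimeIdeals.
Variables (D q : set F).
Hypotheses (sD : subring D) (pq : prime_ideal D q).

Lemma primeW a : q a -> D a. Proof. by case: pq => -[h _] *; apply: h. Qed.
Lemma prime0 : q 0. Proof. by case: pq => -[]. Qed.
Lemma primeD a b : q a -> q b -> q (a + b). Proof. by case: pq => _ h *; apply: h. Qed.
Lemma primeM a b : D a -> q b -> q (a * b).
Proof. by case: pq => _ _ h *; apply: h. Qed.
Lemma primeMr a b : D b -> q a -> q (a * b).
Proof. by move=> *; rewrite mulrC; apply: primeM. Qed.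
Lemma primeN a : q a -> q (- a).
Proof.
by move=> qa; rewrite -mulN1r; apply: primeM => //; apply: subringN => //; apply: subring1.
Qed.
Lemma primeB a b : q a -> q b -> q (a - b).
Proof. by move=> qa qb; apply: primeD => //; apply: primeN. Qed.
Lemma prime1 : ~ q 1. Proof. by case: pq. Qed.
Lemma prime_mul a b : D a -> D b -> q (a * b) -> q a \/ q b.
Proof. by case: pq => _ _ _ _ h *; apply: h. Qed.
Lemma nprimeM a b : D a -> D b -> ~ q a -> ~ q b -> ~ q (a * b).
Proof. by move=> Da Db na nb /(prime_mul Da Db)[]. Qed.
Lemma nprime_neq0 a : ~ q a -> a != 0.
Proof. by move=> nqa; apply/eqP => a0; apply: nqa; rewrite a0; apply: prime0. Qed.

Lemma locI a b : D a -> D b -> ~ q b -> localization D q (a / b).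
Proof. by move=> Da Db nb; exists a => //; exists b. Qed.

Lemma locE x : localization D q x ->
  exists a b, [/\ D a, D b, ~ q b, b != 0 & x = a / b].
Proof.
move=> [a Da [b [Db nb] <-]]; exists a, b; split=> //; exact: nprime_neq0.
Qed.

Lemma locW a : D a -> localization D q a.
Proof.
by move=> Da; rewrite -[a]divr1; apply: locI => //; [apply: subring1|apply: prime1].
Qed.

Lemma loc_subring : subring (localization D q).
Proof.
split; first by apply: locW; apply: subring1.
- move=> _ _ /locE[a [b [Da Db nb b0 ->]]] /locE[c [d [Dc Dd nd d0 ->]]].
  rewrite (_ : _ - _ = (a * d - c * b) / (b * d)); last by field; rewrite b0 d0.
  apply: locI; [|exact: subringM|exact: nprimeM].
  by apply: subringB => //; apply: subringM.
move=> _ _ /locE[a [b [Da Db nb b0 ->]]] /locE[c [d [Dc Dd nd d0 ->]]].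
rewrite (_ : _ * _ = (a * c) / (b * d)); last by field; rewrite b0 d0.
by apply: locI; [exact: subringM|exact: subringM|exact: nprimeM].
Qed.

Lemma loc_maxid x : maxid (localization D q) x <->
  exists a b, [/\ q a, D b, ~ q b, b != 0 & x = a / b].
Proof.
split=> [[/locE[a [b [Da Db nb b0 ->]]] nu]|].
  exists a, b; split=> //; apply: contrapT => nqa; apply: nu.
  have a0 := nprime_neq0 nqa.
  by exists (b / a); split; [exact: locI|field; rewrite a0 b0].
move=> [a [b [qa Db nb b0 ->]]]; split; first by apply: locI => //; apply: primeW.
move=> [_ [/locE[c [d [Dc Dd nd d0 ->]]] abcd]].
apply: (nprimeM Db Dd nb nd).
rewrite (_ : b * d = a * c); first exact: primeMr.
by rewrite -[LHS]mul1r -abcd; field; rewrite b0 d0.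
Qed.

Lemma loc_maxidI a b : q a -> D b -> ~ q b -> maxid (localization D q) (a / b).
Proof.
by move=> qa Db nb; apply/loc_maxid; exists a, b; split=> //; apply: nprime_neq0.
Qed.

Lemma loc_maxidW a : q a -> maxid (localization D q) a.
Proof.
by move=> qa; rewrite -[a]divr1; apply: loc_maxidI => //; [apply: subring1|apply: prime1].
Qed.

Lemma loc_maxid_prime a : D a -> maxid (localization D q) a -> q a.
Proof.
move=> Da /loc_maxid[c [b [qc Db nb b0 eqa]]].
have : q (a * b) by rewrite eqa divfK.
by case/(prime_mul Da Db).
Qed.

Lemma loc_local : local_ring (localization D q).
Proof.
split; first exact: loc_subring.
move=> _ _ /loc_maxid[a [b [qa Db nb b0 ->]]] /loc_maxid[c [d [qc Dd nd d0 ->]]].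
rewrite (_ : _ + _ = (a * d + c * b) / (b * d)); last by field; rewrite b0 d0.
apply: loc_maxidI; [|exact: subringM|exact: nprimeM].
by apply: primeD; apply: primeMr.
Qed.

End PrimeIdeals.

Lemma maxid_prime V D : local_ring V -> subring D -> D `<=` V ->
  prime_ideal D (maxid V `&` D).
Proof.
move=> lV sD DV; have sV := lV.1; split.
- by split=> [x []|] //; split; [exact: maxid0|exact: subring0].
- by move=> a b [ma Da] [mb Db]; split; [apply: lV.2|apply: subringD].
- by move=> a b Da [mb Db]; split; [apply: maxidM => //; apply: DV|apply: subringM].
- by move=> [/(maxid1 sV)].
move=> a b Da Db [mab _].
have [ma|na] := pselect (maxid V a); first by left.
right; split=> //; apply: contrapT => nb.
by apply: nmaxidM mab => //; apply: DV.
Qed.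

(* Two affine charts with a common point have the same local ring there. *)
Lemma localization_change D D' q (C := localization D q) (q' := maxid C `&` D') :
  subring D -> prime_ideal D q -> subring D' -> D' `<=` C ->
  D `<=` localization D' q' -> prime_ideal D' q' /\ C = localization D' q'.
Proof.
move=> sD pq sD' D'C DC'; have lC : local_ring C := loc_local sD pq.
have sC := lC.1.
have pq' : prime_ideal D' q' by apply: maxid_prime.
have sC' := loc_subring sD' pq'.
split=> //; apply/seteqP; split=> x; last first.
  move=> /(locE pq')[a [b [Da Db nb b0 ->]]].
  have nmb : ~ maxid C b by move=> mb; apply: nb.
  have [_ Cb] := nmaxid (D'C _ Db) nmb.
  by apply: subringM => //; apply: D'C.
move=> /(locE pq)[a [b [Da Db nb b0 ->]]].
apply: subringM => //; first exact: DC'.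
have /(locE pq')[s [t [Ds Dt nt t0 eqb]]] := DC' _ Db.
have s0 : s != 0 by apply/eqP => s0; move/eqP: b0; apply; rewrite eqb s0 mul0r.
rewrite eqb (_ : (s / t)^-1 = t / s); last by field; rewrite s0 t0.
apply: locI => // -[ms _].
have nmb : ~ maxid C b by move=> /(loc_maxid_prime pq Db).
have nmt : ~ maxid C t by move=> mt; apply: nt.
apply: (nmaxidM sC (locW sD pq Db) (D'C _ Dt) nmb nmt).
by rewrite eqb divfK.
Qed.

End LocalSubrings.

(** * Values of polynomials *)

Section PolynomialValues.
Local Open Scope ring_scope.
Variables (k F : fieldType) (i : {rmorphism k -> F}).
Implicit Types (P Q : {poly k}) (z : F).

Lemma pevalD P Q z : peval i (P + Q) z = peval i P z + peval i Q z.
Proof. by rewrite /peval rmorphD hornerD. Qed.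

Lemma pevalB P Q z : peval i (P - Q) z = peval i P z - peval i Q z.
Proof. by rewrite /peval rmorphB hornerD hornerN. Qed.

Lemma pevalM P Q z : peval i (P * Q) z = peval i P z * peval i Q z.
Proof. by rewrite /peval rmorphM hornerM. Qed.

Lemma pevalC c z : peval i c%:P z = i c.
Proof. by rewrite /peval map_polyC hornerC. Qed.

Lemma pevalX z : peval i 'X z = z.
Proof. by rewrite /peval map_polyX hornerX. Qed.

Lemma pevalXn n z : peval i 'X^n z = z ^+ n.
Proof. by rewrite /peval map_polyXn hornerXn. Qed.

Lemma peval0 z : peval i 0 z = 0.
Proof. by rewrite /peval rmorph0 horner0. Qed.

Lemma peval_subring (B : set F) P z :
  subring B -> (forall c, B (i c)) -> B z -> B (peval i P z).
Proof.
move=> sB kB Bz; elim/poly_ind: P => [|P c IH]; first by rewrite peval0; apply: subring0.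
by rewrite pevalD pevalM pevalX pevalC; apply: subringD => //; apply: subringM.
Qed.

End PolynomialValues.

(** * Regular parameters *)

Section Regular.
Local Open Scope classical_set_scope.
Local Open Scope ring_scope.
Variables (k F : fieldType) (i : {rmorphism k -> F}).
Implicit Types (A B C D V q : set F) (a b x : F) (P : {poly k}).

Definition ideal2 B s t x := exists a b, [/\ B a, B b & x = a * s + b * t].

(* B is a two-dimensional regular local ring with residue field k and regular
   parameters u, v; the last clause says that u, v is a regular sequence. *)
Definition regular B u v :=
  [/\ subring B, forall c, B (i c), forall x, maxid B x <-> ideal2 B u v x,
      forall x, B x -> exists c, maxid B (x - i c)
    & u != 0 /\ forall a b, B a -> B b -> a * v = b * u -> exists2 d, B d & a = d * u].

Section RegularTheory.
Variables (A : set F) (u v : F).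
Hypothesis rA : regular A u v.

Lemma reg_subring : subring A. Proof. by case: rA. Qed.
Lemma reg_const c : A (i c). Proof. by case: rA. Qed.
Lemma reg_maxid x : maxid A x <-> ideal2 A u v x. Proof. by case: rA. Qed.
Lemma reg_neq0 : u != 0. Proof. by case: rA => _ _ _ _ []. Qed.
Lemma reg_residue x : A x -> exists c, maxid A (x - i c).
Proof. by case: rA => _ _ _ h _; apply: h. Qed.

Let sA := reg_subring.

Lemma reg_local : local_ring A.
Proof.
split=> // _ _ /reg_maxid[a [b [Aa Ab ->]]] /reg_maxid[c [d [Ac Ad ->]]].
apply/reg_maxid; exists (a + c), (b + d).
by split; [exact: subringD|exact: subringD|ring].
Qed.

Lemma reg_maxid_u : maxid A u.
Proof.
apply/reg_maxid; exists 1, 0; split; [exact: subring1|exact: subring0|ring].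
Qed.

Lemma reg_maxid_v : maxid A v.
Proof.
apply/reg_maxid; exists 0, 1; split; [exact: subring0|exact: subring1|ring].
Qed.

Lemma reg_u : A u. Proof. exact: maxidW reg_maxid_u. Qed.
Lemma reg_v : A v. Proof. exact: maxidW reg_maxid_v. Qed.

Lemma reg_neq0r : v != 0.
Proof.
apply/eqP => v0; case: rA => _ _ _ _ [u0 h].
have [d Ad d1] : exists2 d, A d & 1 = d * u.
  apply: (h 1 0); [exact: subring1|exact: subring0|by rewrite v0 mulr0 mul0r].
by apply: (maxid1 sA); rewrite d1; apply: maxidM => //; apply: reg_maxid_u.
Qed.

Lemma maxid_const c : maxid A (i c) -> c = 0.
Proof.
move=> mc; apply/eqP; apply: contrapT => /negP c0.
by apply: (maxid_inv _ _ mc); rewrite ?fmorph_eq0 // -fmorphV; apply: reg_const.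
Qed.

(** If u divides b v it divides b, and a factor u cancels in F. For n = 1 this is the regular
    sequence property with u and v exchanged, as [reg_sym] needs. *)
Lemma reg_dvd n a b : A a -> A b -> a * u ^+ n = b * v -> exists2 d, A d & a = d * v.
Proof.
case: rA => _ _ _ _ [u0 h].
elim: n a b => [|n IH] a b Aa Ab; first by rewrite expr0 mulr1 => ->; exists b.
move=> e; have [d Ad bE] : exists2 d, A d & b = d * u.
  apply: (h b (a * u ^+ n)) => //; last by rewrite -e exprSr mulrA.
  by apply: subringM => //; apply: subringX => //; apply: reg_u.
apply: (IH a d Aa Ad); apply: (mulIf u0).
by rewrite -mulrA -exprSr e bE; ring.
Qed.

Lemma reg_sym : regular A v u.
Proof.
split; first exact: sA.
- exact: reg_const.
- move=> x; split=> [/reg_maxid[a [b [Aa Ab ->]]]|[a [b [Aa Ab ->]]]].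
    by exists b, a; split=> //; ring.
  by apply/reg_maxid; exists b, a; split=> //; ring.
- exact: reg_residue.
split; first exact: reg_neq0r.
by move=> a b Aa Ab; rewrite -{1}[u]expr1 => /(reg_dvd Aa Ab).
Qed.

Lemma const_pow_ideal n c : ideal2 A (u ^+ n.+1) v (i c * u ^+ n) -> c = 0.
Proof.
move=> [a [b [Aa Ab e]]].
have Acau : A (i c - a * u).
  apply: subringB => //; first exact: reg_const.
  by apply: subringM => //; apply: reg_u.
have [|d Ad e'] := @reg_dvd n _ b Acau Ab; first by rewrite mulrBl e exprS; ring.
apply: maxid_const; rewrite -(subrK (a * u) (i c)) e'.
by apply/reg_maxid; exists a, d; split=> //; ring.
Qed.

(** The monomials u^n v^j with j < m are independent over k modulo (u^(n+1), v^m): the constant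
    coefficient goes by [const_pow_ideal], then the relation is divided by v. At a satellite point,
    where the slope replaces v, this detects the single terms of an initial form. *)
Lemma poly_pow_ideal n m P : (size P <= m)%N ->
  ideal2 A (u ^+ n.+1) (v ^+ m) (u ^+ n * peval i P v) -> P = 0.
Proof.
elim: m P => [|m IH] P; first by rewrite leqn0 size_poly_eq0 => /eqP.
elim/poly_ind: P => // P c _ sP; rewrite pevalD pevalM pevalX pevalC => -[a [d [Aa Ad e]]].
have AP : A (peval i P v) := peval_subring P sA reg_const reg_v.
have Aun : A (u ^+ n) by apply: subringX => //; apply: reg_u.
have Avm : A (v ^+ m) by apply: subringX => //; apply: reg_v.
have c0 : c = 0.
  apply: (@const_pow_ideal n); exists a, (d * v ^+ m - u ^+ n * peval i P v).
  split=> //; first by apply: subringB => //; apply: subringM.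
  have -> : i c * u ^+ n =
    u ^+ n * (peval i P v * v + i c) - u ^+ n * peval i P v * v by ring.
  by rewrite e !exprS; ring.
(* With c = 0, the multiple a u^(n+1) is divisible by v, hence so is a. *)
have [||s As aE] := @reg_dvd n.+1 a (u ^+ n * peval i P v - d * v ^+ m) Aa.
- by apply: subringB => //; apply: subringM.
- have -> : (u ^+ n * peval i P v - d * v ^+ m) * v =
    u ^+ n * (peval i P v * v + i c) - d * v ^+ m.+1 by rewrite c0 rmorph0 exprS; ring.
  by rewrite e; ring.
have P0 : P = 0.
  apply: IH.
    have [->|P0] := eqVneq P 0; first by rewrite size_poly0.
    by rewrite size_MXaddC (negPf P0) /= ltnS in sP.
  exists s, d; split=> //; apply: (mulIf reg_neq0r).
  have -> : u ^+ n * peval i P v * v = u ^+ n * (peval i P v * v + i c).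
    by rewrite c0 rmorph0; ring.
  by rewrite e aE !exprS; ring.
by rewrite P0 c0 mul0r add0r.
Qed.

(** The n-th power of the ideal (u, v), encoded so that membership splits off one factor u or v at a
    time. *)
Fixpoint maxid_pow n : set F :=
  if n is n'.+1 then [set x | exists a b, [/\ maxid_pow n' a, maxid_pow n' b & x = u * a + v * b]]
  else A.

Lemma maxid_powS n x : maxid_pow n.+1 x ->
  exists a b, [/\ maxid_pow n a, maxid_pow n b & x = u * a + v * b].
Proof. by []. Qed.

Lemma maxid_powD n a b : maxid_pow n a -> maxid_pow n b -> maxid_pow n (a + b).
Proof.
elim: n a b => [|n IH] a b /=; first exact: subringD.
move=> [a1 [a2 [h1 h2 ->]]] [b1 [b2 [h3 h4 ->]]].
by exists (a1 + b1), (a2 + b2); split; [exact: IH|exact: IH|ring].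
Qed.

Lemma maxid_powM n m a b : maxid_pow n a -> maxid_pow m b -> maxid_pow (n + m) (a * b).
Proof.
elim: n a => [|n IH] a /= ha hb.
  rewrite add0n; elim: m b hb => [|m IH] b /= hb; first exact: subringM.
  case: hb => b1 [b2 [h1 h2 ->]].
  by exists (a * b1), (a * b2); split; [exact: IH|exact: IH|ring].
case: ha => a1 [a2 [h1 h2 ->]].
by exists (a1 * b), (a2 * b); split; [exact: IH|exact: IH|ring].
Qed.

Lemma maxid_pow0 n : maxid_pow n 0.
Proof.
elim: n => [|n IH] /=; first exact: subring0.
by exists 0, 0; split=> //; ring.
Qed.

Lemma maxid_pow_u n a : maxid_pow n a -> maxid_pow n.+1 (u * a).
Proof. by move=> h; exists a, 0; split=> //; [exact: maxid_pow0|ring]. Qed.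

Lemma maxid_pow_v n a : maxid_pow n a -> maxid_pow n.+1 (v * a).
Proof. by move=> h; exists 0, a; split=> //; [exact: maxid_pow0|ring]. Qed.

Lemma maxid_pow_sub n a : maxid_pow n a -> A a.
Proof.
elim: n a => [|n IH] a //= [b [c [/IH Ab /IH Ac ->]]].
by apply: subringD => //; apply: subringM => //; [exact: reg_u|exact: reg_v].
Qed.

Lemma maxid_powMl n a b : A a -> maxid_pow n b -> maxid_pow n (a * b).
Proof. by move=> Aa hb; rewrite -[n]add0n; apply: maxid_powM. Qed.

Lemma maxid_powB n a b : maxid_pow n a -> maxid_pow n b -> maxid_pow n (a - b).
Proof.
move=> ha hb; apply: maxid_powD => //; rewrite -mulN1r; apply: maxid_powMl => //.
by apply: subringN => //; apply: subring1.
Qed.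

Lemma maxid_sub_pow1 a : maxid A a -> maxid_pow 1 a.
Proof. by move/reg_maxid => [s [t [As At ->]]]; exists s, t; split=> //; ring. Qed.

Lemma maxid_pow_ideal n a : maxid_pow n a -> ideal2 A (u ^+ n) v a.
Proof.
elim: n a => [|n IH] a /=.
  move=> Aa; exists a, 0; split=> //; [exact: subring0|by rewrite expr0; ring].
move=> [b [c [/IH[s [t [As At ->]]] hc ->]]].
exists s, (u * t + c); split=> //; last by rewrite exprS; ring.
apply: subringD => //; last exact: maxid_pow_sub hc.
by apply: subringM => //; apply: reg_u.
Qed.

(** A monomial of degree n + m in u and v is divisible by u^n or by v^m. *)
Lemma maxid_pow_ideal2 n m a : maxid_pow (n + m) a -> ideal2 A (u ^+ n) (v ^+ m) a.
Proof.
elim: m n a => [|m IH] n a.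
  rewrite addn0 => /maxid_pow_sub Aa; exists 0, a; split=> //; last by rewrite expr0; ring.
  exact: subring0.
elim: n a => [|n IHn] a.
  move=> /maxid_pow_sub Aa; exists a, 0; split=> //; last by rewrite expr0; ring.
  exact: subring0.
rewrite addSn => /maxid_powS[b [c [/IHn[s [t [As At ->]]] hc ->]]].
rewrite -addSnnS in hc; have [s' [t' [As' At' ->]]] := IH n.+1 c hc.
exists (s + v * s'), (u * t + t'); split; last by rewrite !exprS; ring.
  by apply: subringD => //; apply: subringM => //; apply: reg_v.
by apply: subringD => //; apply: subringM => //; apply: reg_u.
Qed.

(** The initial form of v is not a zero divisor in the associated graded ring. From v x = u a + v b,
    v divides a, say a = d v; then x = u d + b and the induction applies to v d = a. *)
Lemma maxid_pow_colon n x : A x -> maxid_pow n.+1 (v * x) -> maxid_pow n x.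
Proof.
elim: n x => [|n IH] x // Ax /maxid_powS[a [b [ha hb e]]].
have Axb : A (x - b) by apply: subringB => //; apply: maxid_pow_sub hb.
have [|d Ad e'] := @reg_dvd 1 a (x - b) (maxid_pow_sub ha) Axb.
  by rewrite expr1 mulrBl [x * v]mulrC e; ring.
have xE : x = u * d + b.
  apply: (mulfI reg_neq0r); rewrite e e'; ring.
rewrite xE; apply: maxid_powD => //; apply: maxid_pow_u; apply: IH => //.
by rewrite mulrC -e'.
Qed.

Definition slope : F := v / u.
Local Notation z := slope.

Lemma slopeE : v = u * z.
Proof. by rewrite /slope mulrC divfK // reg_neq0. Qed.

(** Here u^n P(v / u) is the homogenization of P, a form of degree n in u and v. *)
Lemma form_maxid_pow n P : (size P <= n.+1)%N -> maxid_pow n (u ^+ n * peval i P z).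
Proof.
elim: n P => [|n IH] P sP.
  rewrite expr0 mul1r (size1_polyC sP) pevalC; exact: reg_const.
elim/poly_ind: P sP => [_|P c _ sP]; first by rewrite peval0 mulr0; apply: maxid_pow0.
rewrite pevalD pevalM pevalX pevalC.
have -> : u ^+ n.+1 * (peval i P z * z + i c) =
  u * (u ^+ n * peval i c%:P z) + v * (u ^+ n * peval i P z).
  by rewrite pevalC slopeE exprS; ring.
apply: maxid_powD; [apply: maxid_pow_u|apply: maxid_pow_v]; apply: IH.
  by rewrite (leq_trans (size_polyC_leq1 _)).
have [->|P0] := eqVneq P 0; first by rewrite size_poly0.
by rewrite size_MXaddC (negPf P0) /= ltnS in sP.
Qed.

Lemma maxid_pow_form n g : maxid_pow n g ->
  exists P h, [/\ (size P <= n.+1)%N, maxid_pow n.+1 h & g = u ^+ n * peval i P z + h].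
Proof.
elim: n g => [|n IH] g.
  move=> /reg_residue[c mc]; exists c%:P, (g - i c); split.
  - exact: size_polyC_leq1.
  - exact: maxid_sub_pow1.
  by rewrite pevalC expr0; ring.
move=> /maxid_powS[a [b [/IH[P [g1 [sP h1 ->]]] /IH[Q [g2 [sQ h2 ->]]] ->]]].
exists (P + 'X * Q), (u * g1 + v * g2); split.
- rewrite (leq_trans (size_polyD _ _)) // geq_max (leq_trans sP) //=.
  have [->|Q0] := eqVneq Q 0; first by rewrite mulr0 size_poly0.
  by rewrite mulrC size_mulX.
- by exists g1, g2.
by rewrite pevalD pevalM pevalX slopeE exprS; ring.
Qed.

(** Uniqueness of the initial form. Modulo v only the term in u^n survives, and [const_pow_ideal]
    kills it; the rest is divisible by v, and [maxid_pow_colon] lowers the degree. *)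
Lemma form_maxid_pow_eq0 n P : (size P <= n.+1)%N ->
  maxid_pow n.+1 (u ^+ n * peval i P z) -> P = 0.
Proof.
elim: n P => [|n IH] P sP.
  rewrite expr0 mul1r (size1_polyC sP) pevalC => /maxid_powS[a [b [Aa Ab e]]].
  rewrite (@maxid_const P`_0) ?polyC0 //.
  by apply/reg_maxid; exists a, b; split=> //; rewrite e; ring.
elim/poly_ind: P sP => // P c _ sP; rewrite pevalD pevalM pevalX pevalC => h.
have sP' : (size P <= n.+1)%N.
  have [->|P0] := eqVneq P 0; first by rewrite size_poly0.
  by rewrite size_MXaddC (negPf P0) /= ltnS in sP.
have hP := form_maxid_pow sP'.
have e : u ^+ n.+1 * (peval i P z * z + i c) = i c * u ^+ n.+1 + v * (u ^+ n * peval i P z).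
  by rewrite slopeE exprS; ring.
rewrite e in h.
have c0 : c = 0.
  have [a [b [Aa Ab e']]] := maxid_pow_ideal h.
  apply: (@const_pow_ideal n.+1); exists a, (b - u ^+ n * peval i P z); split=> //.
    by apply: subringB => //; apply: maxid_pow_sub hP.
  by rewrite mulrBl addrA -e'; ring.
rewrite c0 rmorph0 mul0r add0r in h.
rewrite c0 (IH P) // ?mul0r ?add0r //; apply: maxid_pow_colon => //.
exact: maxid_pow_sub hP.
Qed.

End RegularTheory.
End Regular.

(** * Charts of a blow-up *)

Section Chart.
Local Open Scope classical_set_scope.
Local Open Scope ring_scope.
Variables (F : fieldType).
Implicit Types (A B C D T V q : set F) (a b x : F).

Lemma chart_subring A u : subring (blowup_chart A u).
Proof.
split; first by move=> T [[]].
- by move=> a b ha hb T [sT hT]; apply: subringB => //; [apply: ha|apply: hb].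
by move=> a b ha hb T [sT hT]; apply: subringM => //; [apply: ha|apply: hb].
Qed.

Lemma chartW A u : A `<=` blowup_chart A u.
Proof. by move=> x Ax T [_ hT]; apply: hT; left. Qed.

Lemma chart_quot A u w : maxid A w -> blowup_chart A u (w / u).
Proof. by move=> mw T [_ hT]; apply: hT; right; exists w. Qed.

Lemma chart_sub A u T : subring T -> A `<=` T ->
  (forall w, maxid A w -> T (w / u)) -> blowup_chart A u `<=` T.
Proof.
by move=> sT AT hT x; apply; split=> // y [/AT//|[w mw <-]]; apply: hT.
Qed.

(** Since w / u always lies in the chart of u, the condition [C (u / w)] makes it a unit at the
    point, which therefore also lies in the chart of w. *)
Lemma chart_change A u w q (C := localization (blowup_chart A u) q)
    (q' := maxid C `&` blowup_chart A w) :
  prime_ideal (blowup_chart A u) q -> maxid A u -> maxid A w ->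
  u != 0 -> w != 0 -> C (u / w) ->
  prime_ideal (blowup_chart A w) q' /\ C = localization (blowup_chart A w) q'.
Proof.
move=> pq mu mw u0 w0 Cuw.
have sD := chart_subring A u; have sD' := chart_subring A w.
have lC : local_ring C := loc_local sD pq; have sC := lC.1.
have Cq x : maxid A x -> C (x / u) by move=> mx; apply: locW => //; apply: chart_quot.
have D'C : blowup_chart A w `<=` C.
  apply: chart_sub => //; first by move=> x Ax; apply: locW => //; apply: chartW.
  move=> x mx; rewrite (_ : x / w = x / u * (u / w)); first exact: subringM (Cq _ mx) Cuw.
  by field; rewrite u0 w0.
have pq' : prime_ideal (blowup_chart A w) q' by apply: maxid_prime.
apply: localization_change => //; apply: chart_sub.
- exact: loc_subring.
- by move=> x Ax; apply: locW => //; apply: chartW.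
move=> x mx; rewrite (_ : x / u = (x / w) / (u / w)); last by field; rewrite u0 w0.
apply: locI => //; try exact: chart_quot.
move=> [m _]; apply: maxid_inv m; first by rewrite mulf_neq0 // invr_eq0.
by rewrite invf_div; apply: Cq.
Qed.

Variables (k : fieldType) (i : {rmorphism k -> F}).
Implicit Types (P : {poly k}).

Section OneChart.
Variables (A : set F) (u v : F).
Hypothesis rA : regular i A u v.
Local Notation D := (blowup_chart A u).
Local Notation z := (slope u v).

Let sA := reg_subring rA.
Let sD := chart_subring A u.
Let u0 := reg_neq0 rA.
Let Du : D u. Proof. exact: (chartW (reg_u rA)). Qed.
Let Dk c : D (i c). Proof. exact: (chartW (reg_const rA c)). Qed.

Lemma chart_slope : D z.
Proof. exact: (chart_quot (reg_maxid_v rA)). Qed.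

Let Dz := chart_slope.
Let Dp P : D (peval i P z). Proof. exact: (peval_subring P sD Dk Dz). Qed.

Lemma reg_chart_sub T : subring T -> A `<=` T -> T z -> D `<=` T.
Proof.
move=> sT AT Tz; apply: chart_sub => // w /(reg_maxid rA)[a [b [Aa Ab ->]]].
rewrite (_ : _ / u = a + b * z); last by rewrite /slope; field.
by apply: (subringD sT); [apply: AT|apply: (subringM sT) => //; apply: AT].
Qed.

(** Modulo u each element of A is a constant, so z generates the quotient of the chart ring by u
    over k. With [chart_poly_eq0] this identifies the quotient with k[z]. *)
Lemma chart_dec d : D d -> exists P d', D d' /\ d = peval i P z + u * d'.
Proof.
have sT : subring [set d | D d /\ exists P d', D d' /\ d = peval i P z + u * d'].
  split.
  - split; first by apply: (subring1 sD).
    by exists 1, 0; split; [by apply: (subring0 sD)|rewrite -polyC1 pevalC rmorph1; ring].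
  - move=> a b [Da [P [a' [Da' ->]]]] [Db [Q [b' [Db' ->]]]].
    split; first by apply: (subringB sD) => //; apply: (subringD sD) => //; apply: (subringM sD).
    exists (P - Q), (a' - b'); split; first by apply: (subringB sD).
    by rewrite pevalB; ring.
  move=> a b [Da [P [a' [Da' ea]]]] [Db [Q [b' [Db' eb]]]].
  split; first by apply: (subringM sD).
  exists (P * Q), (peval i P z * b' + a' * b); split.
    by apply: (subringD sD) => //; apply: (subringM sD).
  by rewrite pevalM ea eb; ring.
move=> Dd; suff [] : [set d | D d /\ exists P d', D d' /\ d = peval i P z + u * d'] d by [].
apply: (reg_chart_sub sT) Dd => [x Ax|]; last first.
  split=> //; exists 'X, 0; split; first by apply: (subring0 sD).
  by rewrite pevalX; ring.
split; first by apply: chartW.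
have [c /(reg_maxid rA)[a [b [Aa Ab e]]]] := reg_residue rA Ax.
exists c%:P, (a + b * z); split.
  by apply: (subringD sD) => //; [apply: chartW|apply: (subringM sD) => //; apply: chartW].
by rewrite pevalC -[LHS](subrK (i c)) e [in LHS](slopeE rA); ring.
Qed.

(** Clearing denominators: u^n (v / u)^j is a form of degree n as soon as n is at least j. *)
Lemma chart_maxid_pow d : D d -> exists n, maxid_pow A u v n (u ^+ n * d).
Proof.
have shift n m x : maxid_pow A u v n (u ^+ n * x) -> maxid_pow A u v (m + n) (u ^+ (m + n) * x).
  elim: m => [|m IH] // /IH h; rewrite addSn exprS -mulrA; by apply: (maxid_pow_u rA).
have sT : subring [set d | exists n, maxid_pow A u v n (u ^+ n * d)].
  split.
  - by exists 0%N; rewrite expr0 mul1r; apply: (subring1 sA).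
  - move=> a b [n ha] [m hb]; exists (n + m)%N; rewrite mulrBr; apply: (maxid_powB rA) => //.
      by rewrite addnC; apply: shift.
    exact: shift.
  move=> a b [n ha] [m hb]; exists (n + m)%N.
  rewrite exprD (_ : _ * _ = (u ^+ n * a) * (u ^+ m * b)); last by ring.
  by apply: (maxid_powM rA).
apply: (reg_chart_sub sT) => [x Ax|]; first by exists 0%N; rewrite expr0 mul1r.
exists 1%N; rewrite expr1 -(slopeE rA); apply: (maxid_sub_pow1 rA) => //; exact: (reg_maxid_v rA).
Qed.

Lemma maxid_pow_chart n g : maxid_pow A u v n g -> exists2 d, D d & g = u ^+ n * d.
Proof.
elim: n g => [|n IH] g; first by move=> Ag; exists g; [by apply: chartW|rewrite expr0 mul1r].
move=> /maxid_powS[a [b [/IH[d Dd ->] /IH[e De ->] ->]]].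
exists (d + z * e); first by apply: (subringD sD) => //; apply: (subringM sD).
by rewrite [in LHS](slopeE rA) exprS; ring.
Qed.

(** For large N, u^N P(z) is a form of degree N lying in (u, v)^(N+1), hence zero by uniqueness of
    initial forms. N must bound the degree of P, whence the shift by [size P]. *)
Lemma chart_poly_eq0 P d : D d -> peval i P z = u * d -> P = 0.
Proof.
move=> /chart_maxid_pow[n hd] e.
have h m : maxid_pow A u v (m + n).+1 (u ^+ (m + n) * peval i P z).
  elim: m => [|m IH]; last by rewrite addSn exprS -mulrA; apply: (maxid_pow_u rA).
  by rewrite add0n e mulrCA; apply: (maxid_pow_u rA).
apply: (form_maxid_pow_eq0 rA _ (h (size P))).
by rewrite ltnW // ltnS leq_addr.
Qed.

Definition exc_ideal : set F := [set u * d | d in D].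

Lemma exc_poly_eq0 P : exc_ideal (peval i P z) -> P = 0.
Proof. by move=> [d Dd e]; apply: (chart_poly_eq0 Dd). Qed.

Lemma exc_prime : prime_ideal D exc_ideal.
Proof.
split.
- split=> [_ [d Dd <-]|]; first by apply: (subringM sD).
  by exists 0; [by apply: (subring0 sD)|rewrite mulr0].
- by move=> _ _ [a Da <-] [b Db <-]; exists (a + b); [by apply: (subringD sD)|ring].
- by move=> a _ Da [b Db <-]; exists (a * b); [by apply: (subringM sD)|ring].
- move=> e1; have := @exc_poly_eq0 1; rewrite -polyC1 pevalC rmorph1 => /(_ e1)/eqP.
  by rewrite polyC1 oner_eq0.
move=> a b /chart_dec[P [a' [Da' ->]]] /chart_dec[Q [b' [Db' ->]]] [d Dd e].
have /eqP : P * Q = 0.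
  (* The witness comes from expanding (P(z) + u a') (Q(z) + u b') = u d and solving for P(z)
     Q(z). *)
  apply: (@chart_poly_eq0 _ (d - a' * peval i Q z - b' * peval i P z - u * a' * b')).
    by do !apply: (subringB sD) => //; do !apply: (subringM sD) => //.
  rewrite pevalM !mulrBr e; ring.
rewrite mulf_eq0 => /orP[]/eqP->; rewrite peval0 add0r; [left|right].
  by exists a'.
by exists b'.
Qed.

Lemma exc_sub q : prime_ideal D q -> q u -> exc_ideal `<=` q.
Proof. by move=> pq qu _ [d Dd <-]; apply: primeMr pq _ _ Dd qu. Qed.

Lemma exc_u : exc_ideal u.
Proof. by exists 1; [by apply: (subring1 sD)|rewrite mulr1]. Qed.

Definition point_ideal (l : k) : set F := ideal2 D u (z - i l).

Lemma point_u l : point_ideal l u.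
Proof. by exists 1, 0; split; [by apply: (subring1 sD)|by apply: (subring0 sD)|ring]. Qed.

Lemma point_y l : point_ideal l (z - i l).
Proof. by exists 0, 1; split; [by apply: (subring0 sD)|by apply: (subring1 sD)|ring]. Qed.

Lemma point_D l a b : point_ideal l a -> point_ideal l b -> point_ideal l (a + b).
Proof.
move=> [s [t [Ds Dt ->]]] [s' [t' [Ds' Dt' ->]]].
by exists (s + s'), (t + t'); split; [by apply: (subringD sD)|by apply: (subringD sD)|ring].
Qed.

Lemma point_M l a b : D a -> point_ideal l b -> point_ideal l (a * b).
Proof.
move=> Da [s [t [Ds Dt ->]]].
by exists (a * s), (a * t); split; [by apply: (subringM sD)|by apply: (subringM sD)|ring].
Qed.

Lemma poly_residue P l : exists Q, P = Q * ('X - l%:P) + P.[l]%:P.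
Proof.
have /factor_theorem[Q e] : root (P - P.[l]%:P) l.
  by rewrite /root hornerD hornerN hornerC subrr.
by exists Q; rewrite -e subrK.
Qed.

Lemma chart_residue l d : D d -> exists c, point_ideal l (d - i c).
Proof.
move=> /chart_dec[P [d' [Dd' ->]]]; have [Q ->] := poly_residue P l.
exists P.[l], d', (peval i Q z); split=> //.
by rewrite pevalD pevalM pevalB pevalX !pevalC; ring.
Qed.

(** Modulo u the relation becomes c = P (X - l) in k[X], which is evaluated at l. *)
Lemma point_const l c : point_ideal l (i c) -> c = 0.
Proof.
move=> [a [b [Da Db e]]].
have [P [b' [Db' eb]]] := chart_dec Db.
have : c%:P - P * ('X - l%:P) = 0.
  apply: (@chart_poly_eq0 _ (a + b' * (z - i l))).
    by apply: (subringD sD) => //; apply: (subringM sD) => //; apply: (subringB sD).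
  by rewrite pevalB pevalM pevalB pevalX !pevalC e eb; ring.
by move=> /(congr1 (horner^~ l)); rewrite !hornerE subrr mulr0 subr0.
Qed.

Lemma point_prime l : prime_ideal D (point_ideal l).
Proof.
split.
- split=> [_ [s [t [Ds Dt ->]]]|].
    by apply: (subringD sD) => //; apply: (subringM sD) => //; apply: (subringB sD).
  by exists 0, 0; split; [by apply: (subring0 sD)|by apply: (subring0 sD)|ring].
- by apply: point_D.
- by apply: point_M.
- by rewrite -(rmorph1 i) => /point_const/eqP; rewrite oner_eq0.
move=> a b Da Db hab.
have [c hc] := chart_residue l Da; have [d hd] := chart_residue l Db.
have : point_ideal l (i (c * d)).
  have -> : i (c * d) = a * b + (- 1 * (b * (a - i c)) + (- i c) * (b - i d)).
    by rewrite rmorphM; ring.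
  apply: point_D => //; apply: point_D; apply: point_M.
  - by apply: (subringN sD) => //; apply: (subring1 sD).
  - by apply: point_M.
  - by apply: (subringN sD).
  - exact: hd.
move=> /point_const/eqP; rewrite mulf_eq0 => /orP[/eqP c0|/eqP d0].
  by left; move: hc; rewrite c0 rmorph0 subr0.
by right; move: hd; rewrite d0 rmorph0 subr0.
Qed.

Lemma slope_nexc l : ~ exc_ideal (z - i l).
Proof.
move=> h; have /eqP : 'X - l%:P = 0.
  by apply: exc_poly_eq0; rewrite pevalB pevalX pevalC.
by rewrite polyXsubC_eq0.
Qed.

Definition exc_point l : set F := localization D (point_ideal l).
(** The local ring at the generic point of the exceptional curve, with uniformizer u; an element of
    A of order n is u^n times a unit of it ([exc_val_factor]). *)
Definition exc_valuation : set F := localization D exc_ideal.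

(** The regular sequence clause holds because uD is prime and contains neither z - l nor a
    denominator d, the latter being outside the larger ideal of the point. *)
Lemma exc_point_regular l : regular i (exc_point l) u (z - i l).
Proof.
have pp := point_prime l; have pe := exc_prime.
have Dy : D (z - i l) by apply: (subringB sD).
have sC : subring (exc_point l) by apply: loc_subring.
have CD : D `<=` exc_point l by move=> x; apply: locW.
split=> //.
- by move=> c; apply: CD.
- move=> x; split=> [/(loc_maxid pp)[a [b [[s [t [Ds Dt ->]]] Db nb b0 ->]]]|].
    exists (s / b), (t / b); split; [by apply: locI|by apply: locI|by field].
  move=> [a [b [Ca Cb ->]]]; have [_ h] := loc_local sD pp.
  by apply: h; apply: maxidM => //; apply: loc_maxidW => //; [by apply: point_u|by apply: point_y].
- move=> _ /(locE pp)[a [b [Da Db nb b0 ->]]].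
  have [c hc] := chart_residue l Da; have [d hd] := chart_residue l Db.
  have d0 : d != 0 by apply/eqP => d0; apply: nb; move: hd; rewrite d0 rmorph0 subr0.
  have id0 : i d != 0 by rewrite fmorph_eq0.
  exists (c / d); have -> : a / b - i (c / d) =
     ((i d)^-1 * (i d * (a - i c) + (- i c) * (b - i d))) / b.
    by rewrite fmorph_div; field; rewrite id0 b0.
  apply: loc_maxidI => //; apply: point_M; first by rewrite -fmorphV.
  by apply: point_D; apply: point_M => //; apply: (subringN sD).
split=> // _ _ /(locE pp)[a [b [Da Db nb b0 ->]]] /(locE pp)[c [d [Dc Dd nd d0 ->]]] e.
have : exc_ideal (a * ((z - i l) * d)).
  exists (b * c); first by apply: (subringM sD).
  have -> : a * ((z - i l) * d) = (a / b * (z - i l)) * (b * d) by field.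
  by rewrite e; field.
case/(prime_mul pe Da (subringM sD Dy Dd)) => [[s Ds <-]|].
  by exists (s / b); [by apply: locI|field].
case/(prime_mul pe Dy Dd) => [/slope_nexc//|/(exc_sub pp (point_u l)) //].
Qed.

End OneChart.

End Chart.

(** * Points of an exceptional curve *)

Section CurvePoints.
Local Open Scope classical_set_scope.
Local Open Scope ring_scope.
Variables (F : fieldType).
Implicit Types (A B C D T V q : set F) (a b x : F).

(** For B inside V, the preimage in V of the image of B in the residue field: the local ring at the
    point B of the curve with generic point V. *)
Definition plus_maxid V B : set F := [set a + m | a in B & m in maxid V].

Lemma plus_maxidI V B a m : B a -> maxid V m -> plus_maxid V B (a + m).
Proof. by move=> Ba mm; exists a => //; exists m. Qed.

Lemma plus_maxid_subring V D : local_ring V -> subring D -> D `<=` V ->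
  subring (plus_maxid V D).
Proof.
move=> lV sD DV; have sV := lV.1; split.
- rewrite -[1]addr0; apply: plus_maxidI; [exact: (subring1 sD)|exact: maxid0].
- move=> _ _ [a Da [m mm <-]] [b Db [n mn <-]].
  rewrite (_ : _ - _ = (a - b) + (m - n)); last by ring.
  by apply: plus_maxidI; [apply: (subringB sD)|apply: maxidB].
move=> _ _ [a Da [m mm <-]] [b Db [n mn <-]].
rewrite (_ : _ * _ = (a * b) + (a * n + (b + n) * m)); last by ring.
apply: plus_maxidI; first exact: (subringM sD).
apply: lV.2; first exact: maxidM (DV _ Da) mn.
by apply: maxidM => //; apply: (subringD sV); [exact: DV|exact: maxidW].
Qed.

Section Primes.
Variables (V D : set F).
Hypotheses (lV : local_ring V) (sD : subring D) (DV : D `<=` V).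
Let sV := lV.1.

Lemma plus_maxid_prime q : prime_ideal D q -> maxid V `&` D `<=` q ->
  prime_ideal (plus_maxid V D) (plus_maxid V q).
Proof.
move=> pq eq; have qV a : q a -> V a by move=> /(primeW pq)/DV.
split.
- split=> [_ [a qa [m mm <-]]|].
    by apply: plus_maxidI => //; apply: primeW qa.
  by rewrite -[0]addr0; apply: plus_maxidI; [exact: prime0 pq|exact: maxid0].
- move=> _ _ [a qa [m mm <-]] [b qb [n mn <-]].
  rewrite (_ : _ + _ = (a + b) + (m + n)); last by ring.
  by apply: plus_maxidI; [exact: (primeD pq)|apply: lV.2].
- move=> _ _ [a Da [m mm <-]] [b qb [n mn <-]].
  rewrite (_ : _ * _ = (a * b) + (a * n + (b + n) * m)); last by ring.
  apply: plus_maxidI; first exact: (primeM pq).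
  apply: lV.2; first exact: maxidM (DV Da) mn.
  by apply: maxidM => //; apply: (subringD sV); [exact: qV|exact: maxidW].
- move=> [a qa [m mm e]]; apply: (prime1 pq).
  rewrite -e; apply: (primeD pq) => //; apply: eq; split=> //.
  rewrite (_ : m = 1 - a); last by rewrite -e; ring.
  by apply: (subringB sD); [exact: (subring1 sD)|exact: (primeW pq)].
move=> _ _ [a Da [m mm <-]] [b Db [n mn <-]] [c qc [s ms e]].
have : q (a * b).
  rewrite -(subrK c (a * b)); apply: (primeD pq) => //; apply: eq; split; last first.
    by apply: (subringB sD); [exact: (subringM sD)|exact: (primeW pq)].
  rewrite (_ : a * b - c = s - (a * n + (b + n) * m)).
    apply: maxidB => //; apply: lV.2; first exact: maxidM (DV Da) mn.
    by apply: maxidM => //; apply: (subringD sV); [exact: DV|exact: maxidW].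
  apply/eqP; rewrite subr_eq; apply/eqP.
  have -> : s - (a * n + (b + n) * m) + c = c + s - (a * n + (b + n) * m) by ring.
  by rewrite e; ring.
by case/(prime_mul pq Da Db) => h; [left|right]; apply: plus_maxidI.
Qed.

(** A denominator b + n is a unit of V, and replacing (a + m) / (b + n) by a / b changes it by an
    element of [maxid V]. *)
Lemma plus_maxid_localization q : prime_ideal D q -> maxid V `&` D `<=` q ->
  localization (plus_maxid V D) (plus_maxid V q) = plus_maxid V (localization D q).
Proof.
move=> pq eq; have pq' := plus_maxid_prime pq eq.
have nV b : D b -> ~ q b -> ~ maxid V b by move=> Db nb mb; apply: nb; apply: eq.
apply/seteqP; split=> x.
  move=> /(locE pq')[_ [_ [[a Da [m mm <-]] [b Db [n mn <-]] nb bn0 ->]]].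
  have nqb : ~ q b by move=> qb; apply: nb; apply: plus_maxidI.
  have nmb := nV _ Db nqb; have b0 := nprime_neq0 pq nqb.
  have Vb := DV Db; have [_ Vib] := nmaxid Vb nmb.
  have nbn := local_addr_unit lV nmb mn.
  have Vbn : V (b + n) by apply: (subringD sV) => //; apply: maxidW.
  have [_ Vibn] := nmaxid Vbn nbn.
  have -> : (a + m) / (b + n) = a / b + (b^-1 * (b + n)^-1) * (b * m - a * n).
    by field; rewrite b0 bn0.
  apply: plus_maxidI; first exact: locI.
  apply: (maxidM sV (subringM sV Vib Vibn)).
  by apply: (maxidB lV); apply: (maxidM sV) => //; apply: DV.
move=> [_ /(locE pq)[a [b [Da Db nb b0 ->]]] [m mm <-]].
have -> : a / b + m = (a + b * m) / (b + 0) by rewrite addr0; field.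
apply: locI => //.
- by apply: plus_maxidI => //; apply: (maxidM sV) => //; apply: DV.
- by apply: plus_maxidI => //; apply: maxid0.
rewrite addr0 => -[c qc [n mn e]]; apply: nb; rewrite -e.
apply: (primeD pq) => //; apply: eq; split=> //.
rewrite (_ : n = b - c); last by rewrite -e; ring.
by apply: (subringB sD) => //; apply: (primeW pq).
Qed.

Lemma plus_maxid_contract q' : prime_ideal (plus_maxid V D) q' -> maxid V `<=` q' ->
  [/\ prime_ideal D (q' `&` D), maxid V `&` D `<=` q' `&` D
    & q' = plus_maxid V (q' `&` D)].
Proof.
move=> pq' mq'; have DD x : D x -> plus_maxid V D x.
  by move=> Dx; rewrite -[x]addr0; apply: plus_maxidI => //; apply: maxid0.
split; last 2 first.
- by move=> x [mx Dx]; split=> //; apply: mq'.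
- apply/seteqP; split=> x.
    move=> qx; have [a Da [m mm e]] := primeW pq' qx.
    rewrite -e; apply: plus_maxidI => //; split=> //.
    rewrite (_ : a = x - m); last by rewrite -e; ring.
    by apply: (primeB (plus_maxid_subring lV sD DV) pq') => //; apply: mq'.
  by move=> [a [qa Da] [m mm <-]]; apply: (primeD pq') => //; apply: mq'.
split.
- by split=> [x []|] //; split; [exact: prime0 pq'|exact: (subring0 sD)].
- by move=> a b [qa Da] [qb Db]; split; [exact: (primeD pq')|exact: (subringD sD)].
- move=> a b Da [qb Db]; split; last exact: (subringM sD).
  by apply: (primeM pq') => //; apply: DD.
- by move=> [/(prime1 pq')].
by move=> a b Da Db [/(prime_mul pq' (DD _ Da) (DD _ Db))[] h _]; [left|right].
Qed.

End Primes.
End CurvePoints.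

(** * Primes of one chart over the exceptional curve *)

Section ExceptionalCurve.
Local Open Scope classical_set_scope.
Local Open Scope ring_scope.
Variables (F : fieldType) (k : closedFieldType) (i : {rmorphism k -> F}).
Implicit Types (A B C D T V q : set F) (a b x : F) (P : {poly k}).

Section OneChart.
Variables (A : set F) (u v : F).
Hypothesis rA : regular i A u v.
Local Notation D := (blowup_chart A u).
Local Notation z := (slope u v).
Local Notation V := (exc_valuation A u).

Let sD := chart_subring A u.
Let pe := exc_prime rA.

(** These are the primes of the chart ring modulo u, which is k[z]. As k is algebraically closed, a
    nonzero polynomial in the prime splits, and one of its linear factors lies in the prime. *)
Lemma chart_prime_cases q : prime_ideal D q -> q u ->
  q = exc_ideal A u \/ exists l, q = point_ideal i A u v l.
Proof.
move=> pq qu; have Dp P : D (peval i P z).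
  by apply: (peval_subring P sD) => [c|];
     [exact: (chartW (reg_const rA c))|exact: (chart_slope rA)].
have qr d : D d -> exists P, q (d - peval i P z) /\ exc_ideal A u (d - peval i P z).
  move=> /(chart_dec rA)[P [d' [Dd' ->]]]; exists P.
  rewrite addrC addKr; split; last by exists d'.
  by apply: (primeMr pq).
have [[P [P0 qP]]|nP] := pselect (exists P, P != 0 /\ q (peval i P z)); last first.
  left; apply/seteqP; split; last exact: exc_sub.
  move=> x qx; have [P [qd ed]] := qr _ (primeW pq qx).
  have P0 : P = 0.
    apply/eqP; apply: contrapT => /negP P0; apply: nP; exists P; split=> //.
    by rewrite -[peval _ _ _](subKr x); apply: (primeB sD pq).
  by move: ed; rewrite P0 peval0 subr0.
right; have [l ql] : exists l, q (z - i l).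
  have [s e] := closed_field_poly_normal P.
  have : q (peval i (\prod_(x <- s) ('X - x%:P)) z).
    move: qP; rewrite e -mul_polyC pevalM pevalC => /(prime_mul pq _ (Dp _))[||//].
      exact: (chartW (reg_const rA _)).
    move=> qc; exfalso; apply: (prime1 pq).
    rewrite -(@mulVf _ (i (lead_coef P))) ?fmorph_eq0 ?lead_coef_eq0 //.
    apply: (primeM pq) => //; rewrite -fmorphV; exact: (chartW (reg_const rA _)).
  elim: s {e} => [|x s IH].
    by rewrite big_nil -polyC1 pevalC rmorph1 => /(prime1 pq).
  rewrite big_cons pevalM => /(prime_mul pq (Dp _) (Dp _))[|/IH//].
  by rewrite pevalB pevalX pevalC; exists x.
exists l; apply/seteqP; split=> x.
  move=> qx; have [c [s [t [Ds Dt e]]]] := chart_residue rA l (primeW pq qx).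
  have c0 : c = 0.
    apply/eqP; apply: contrapT => /negP c0; apply: (prime1 pq).
    rewrite -(@mulVf _ (i c)) ?fmorph_eq0 //; apply: (primeM pq).
      by rewrite -fmorphV; exact: (chartW (reg_const rA _)).
    rewrite -(subKr x (i c)) e; apply: (primeB sD pq) => //.
    by apply: (primeD pq); apply: (primeM pq).
  by exists s, t; split=> //; rewrite -e c0 rmorph0 subr0.
by move=> [s [t [Ds Dt ->]]]; apply: (primeD pq); apply: (primeM pq).
Qed.

Lemma loc_dominates q : prime_ideal D q -> q u -> dominates (localization D q) A.
Proof.
move=> pq qu; split=> x; first by move=> Ax; apply: locW => //; apply: chartW.
move=> /(reg_maxid rA)[a [b [Aa Ab ->]]]; apply: (loc_maxidW sD pq).
apply: (primeD pq); apply: (primeM pq) => //; try exact: chartW.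
by rewrite (slopeE rA); apply: (primeMr pq) => //; apply: (chart_slope rA).
Qed.

Lemma loc_exceptional q : prime_ideal D q -> q u ->
  exceptional_points A (localization D q).
Proof.
move=> pq qu; exists u; split.
- exact: reg_maxid_u rA.
- exact: reg_neq0 rA.
- by exists q.
exact: loc_dominates.
Qed.

Lemma exc_val_local : local_ring V. Proof. exact: loc_local. Qed.

Lemma exc_val_chart : D `<=` V. Proof. by move=> x; apply: locW. Qed.

Lemma exc_val_maxid : maxid V `&` D = exc_ideal A u.
Proof.
apply/seteqP; split=> x; first by move=> [mx Dx]; apply: loc_maxid_prime mx.
by move=> ex; split; [exact: loc_maxidW|exact: primeW ex].
Qed.

Lemma exc_val_u : maxid V u.
Proof. by apply: loc_maxidW => //; apply: exc_u. Qed.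

Lemma exc_val_dominates : dominates V A.
Proof. by apply: loc_dominates => //; apply: exc_u. Qed.

Lemma exc_val_exceptional : exceptional_points A V.
Proof. by apply: loc_exceptional => //; apply: exc_u. Qed.

Lemma exc_val_y l : D (z - i l) /\ ~ maxid V (z - i l).
Proof.
have Dy : D (z - i l).
  by apply: (subringB sD); [exact: (chart_slope rA)|exact: (chartW (reg_const rA l))].
split=> // my; apply: (@slope_nexc _ _ _ _ _ _ rA l); rewrite -exc_val_maxid //.
Qed.

Lemma exc_val_slopeV : V z^-1.
Proof.
have [Dz nz] := exc_val_y 0; rewrite rmorph0 subr0 in Dz nz.
by have [_] := nmaxid (exc_val_chart Dz) nz.
Qed.

Lemma exc_val_poly P : maxid V (peval i P z) -> P = 0.
Proof.
move=> mP; apply: (exc_poly_eq0 rA); rewrite -exc_val_maxid; split=> //.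
by apply: (peval_subring P sD) => [c|];
     [exact: (chartW (reg_const rA c))|exact: (chart_slope rA)].
Qed.

Lemma slope_neq0 : z != 0.
Proof. by rewrite /slope mulf_neq0 ?invr_eq0 ?(reg_neq0 rA) ?(reg_neq0r rA). Qed.

Lemma slope_inv : z^-1 = slope v u.
Proof. by rewrite /slope invf_div. Qed.

Lemma exc_point_exceptional l : exceptional_points A (exc_point i A u v l).
Proof. by apply: loc_exceptional; [exact: point_prime|exact: point_u]. Qed.

Lemma exc_point_val l : exc_point i A u v l `<=` V.
Proof.
move=> x /(locE (point_prime rA l))[a [b [Da Db nb b0 ->]]].
apply: locI => // eb; apply: nb.
by apply: (exc_sub (point_prime rA l) (point_u i A u v l)).
Qed.

End OneChart.
End ExceptionalCurve.

(** * The exceptional curve as the union of two charts *)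

Section BlowupPoints.
Local Open Scope classical_set_scope.
Local Open Scope ring_scope.
Variables (F : fieldType) (k : closedFieldType) (i : {rmorphism k -> F}).
Implicit Types (A B C D T V q : set F) (a b x : F) (P : {poly k}).

Definition exc_localization A u C :=
  exists q, [/\ prime_ideal (blowup_chart A u) q, q u & C = localization (blowup_chart A u) q].

Lemma affine_ringE A u v (rA : regular i A u v) (V := exc_valuation A u) :
  affine_ring i V (slope u v) = plus_maxid V (blowup_chart A u).
Proof.
apply/seteqP; split=> x.
  move=> [P _ [m mm <-]]; apply: plus_maxidI => //.
  by apply: (peval_subring P (@chart_subring _ A u)) => [c|];
     [exact: (chartW (reg_const rA c))|exact: (chart_slope rA)].
move=> [d /(chart_dec rA)[P [d' [Dd' ->]]] [m mm <-]].
exists P => //; exists (u * d' + m); last by ring.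
have [sV lV] := exc_val_local rA; apply: lV => //; apply: maxidMr => //.
  exact: (exc_val_chart rA).
exact: (exc_val_u rA).
Qed.

(** Reduction modulo [maxid V] matches the primes of the chart ring containing u with the primes of
    k[z], local rings included. *)
Lemma affine_lineE A u v (rA : regular i A u v) (V := exc_valuation A u) :
  affine_line i V (slope u v) = [set plus_maxid V C | C in exc_localization A u].
Proof.
rewrite /affine_line (affine_ringE rA) -/V.
have lV : local_ring V := exc_val_local rA.
have sD := chart_subring A u; have DV := exc_val_chart rA.
have mD := exc_val_maxid rA.
apply/seteqP; split=> B.
  move=> [q' [pq' mq'] <-].
  have [pq eq qE] := plus_maxid_contract lV sD DV pq' mq'.
  set q := q' `&` _ in pq eq qE; exists (localization (blowup_chart A u) q).
    exists q; split=> //; apply: eq; split; first exact: (exc_val_u rA).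
    exact: chartW (reg_u rA).
  by rewrite -(plus_maxid_localization lV sD DV pq eq) -qE.
move=> [_ [q [pq qu ->]] <-].
have eq : maxid V `&` blowup_chart A u `<=` q by rewrite mD; apply: exc_sub.
exists (plus_maxid V q); last exact: plus_maxid_localization.
split; first exact: plus_maxid_prime.
by move=> m mm; rewrite -[m]add0r; apply: plus_maxidI => //; apply: prime0 pq.
Qed.

Section TwoCharts.
Variables (A : set F) (u v : F).
Hypothesis rA : regular i A u v.
Local Notation D := (blowup_chart A u).
Local Notation D' := (blowup_chart A v).
Local Notation z := (slope u v).
Local Notation w := (slope v u).
Local Notation V := (exc_valuation A u).
Let rA' := reg_sym rA.
Let u0 := reg_neq0 rA.
Let v0 := reg_neq0r rA.
Let sA := reg_subring rA.
Let mu := reg_maxid_u rA.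
Let mv := reg_maxid_v rA.

Lemma exc_val_swap : V = exc_valuation A v.
Proof.
have Vw : V (u / v) by have := exc_val_slopeV rA; rewrite slope_inv.
have [pq' e] := chart_change (exc_prime rA) mu mv u0 v0 Vw.
have mVv : maxid V v by have [_] := exc_val_dominates rA; apply.
set q' := _ `&` _ in pq' e.
have qv : q' v by split=> //; exact: (chartW (reg_v rA)).
case: (chart_prime_cases rA' pq' qv) => [qe|[l ql]]; first by rewrite {1}/exc_valuation e qe.
have : q' (w - i l) by rewrite ql; apply: point_y.
(* If the generic point became a point w = l of the other chart, then z (w - l) = 1 - l z would
   vanish on the curve, against the transcendence of z. *)
move=> [mw _]; have : maxid V (peval i (1 - l%:P * 'X) z).
  rewrite pevalB pevalM pevalX pevalC -polyC1 pevalC rmorph1.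
  have -> : 1 - i l * z = z * (w - i l) by rewrite /slope; field; rewrite u0 v0.
  have [sV _] := exc_val_local rA; apply: (maxidM sV) => //.
  by apply: (exc_val_chart rA); apply: (chart_slope rA).
move=> /(exc_val_poly rA)/(congr1 (fun P => P`_0)) /eqP.
by rewrite coefB coefCM coefX mulr0 subr0 coef1 coef0 oner_eq0.
Qed.

Lemma exc_localization_change C : exc_localization A v C -> C z -> exc_localization A u C.
Proof.
move=> [q [pq qv CE]]; rewrite CE => Cz.
have [pq' e] := chart_change pq mv mu v0 u0 Cz.
rewrite e; set q' := _ `&` _ in pq' e *; exists q'; split=> //; split.
  by have [_] := loc_dominates rA' pq qv; apply.
exact: (chartW (reg_u rA)).
Qed.

(** A chart may have any denominator t = a u + b v. As 1 = a (u / t) + b (v / t), one of the two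
    quotients is a unit at the point, which then lies in the chart of u or of v. *)
Lemma exceptional_localization C :
  exceptional_points A C -> exc_localization A u C \/ exc_localization A v C.
Proof.
move=> [t [mt t0 [q pq <-] [AC mAC]]].
have lC := loc_local (chart_subring A t) pq; have sC := lC.1.
set C' := localization _ _ in AC mAC lC sC *.
have Ct x : maxid A x -> C' (x / t).
  by move=> mx; apply: (locW (chart_subring A t)) => //; apply: chart_quot.
have key s : maxid A s -> s != 0 -> ~ maxid C' (s / t) -> exc_localization A s C'.
  move=> ms s0 nm; have [_ Cts] := nmaxid (Ct _ ms) nm; rewrite invf_div in Cts.
  have [pq' e] := chart_change pq mt ms t0 s0 Cts.
  rewrite -/C' in pq' e; exists (maxid C' `&` blowup_chart A s); split=> //; split; first exact: mAC.
  exact: (chartW (maxidW ms)).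
have [mut|nut] := pselect (maxid C' (u / t)); last by left; apply: key.
right; apply: key => // mvt; apply: (maxid1 sC).
have [a [b [Aa Ab e]]] := (reg_maxid rA t).1 mt.
have -> : 1 = a * (u / t) + b * (v / t).
  by apply: (mulIf t0); rewrite mul1r {1}e; field.
by apply: lC.2; apply: maxidM => //; apply: AC.
Qed.

Lemma exc_localization_cases C : exc_localization A u C ->
  C = V \/ exists l, C = exc_point i A u v l.
Proof.
by move=> [q [pq qu ->]]; have [->|[l ->]] := chart_prime_cases rA pq qu;
   [left|right; exists l].
Qed.

(** At a point w = l of the chart of v with l nonzero, z = 1 / w is regular, so the point already
    lies in the chart of u; only w = 0 is left. *)
Lemma exceptional_cases C : exceptional_points A C ->
  [\/ C = V, exists l, C = exc_point i A u v l | C = exc_point i A v u 0].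
Proof.
have h : exc_localization A u C -> [\/ C = V, exists l, C = exc_point i A u v l | C = exc_point i A v u 0].
  by move=> /exc_localization_cases[]; [constructor 1|constructor 2].
move=> /exceptional_localization[//|hC].
case: (hC) => q [pq qv CE].
have [e|[l e]] := chart_prime_cases rA' pq qv.
  by constructor 1; rewrite exc_val_swap CE e.
have [l0|l0] := eqVneq l 0; first by constructor 3; rewrite CE e l0.
apply: h; apply: exc_localization_change => //.
have sD' := chart_subring A v.
have Dw : D' w by exact: (chart_slope rA').
have nw : ~ q w.
  move=> qw; apply/negP: l0; rewrite negbK; apply/eqP.
  apply: (point_const rA' (l := l)); rewrite -e.
  rewrite (_ : i l = w - (w - i l)); last by ring.
  by apply: (primeB sD' pq) => //; rewrite e; apply: point_y.
rewrite CE (_ : z = 1 / w); first by apply: locI => //; apply: (subring1 sD').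
by rewrite /slope; field; rewrite u0 v0.
Qed.

Lemma exceptional_dominates C : exceptional_points A C -> dominates C A.
Proof. by move=> [t []]. Qed.

Lemma exceptional_sub_val C : exceptional_points A C -> C `<=` V.
Proof.
move=> /exceptional_cases[-> //|[l ->]|->]; first exact: exc_point_val.
by rewrite exc_val_swap; apply: (exc_point_val rA').
Qed.

Lemma exceptional_closure :
  [set plus_maxid V C | C in exceptional_points A] =
  affine_line i V z `|` affine_line i V z^-1.
Proof.
rewrite (affine_lineE rA) slope_inv exc_val_swap (affine_lineE rA') -exc_val_swap.
apply/seteqP; split=> B.
  by move=> [C /exceptional_localization[] hC <-]; [left|right]; exists C.
move=> [|] [C [q [pq qt ->]] <-]; eexists; try reflexivity.
  exact: (loc_exceptional rA).
exact: (loc_exceptional rA').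
Qed.

(** The function z - l vanishes at the given point; at any other point of the exceptional curve it
    is a unit or, at infinity, has a pole. *)
Lemma exc_point_separated l C : exceptional_points A C -> C <> exc_point i A u v l ->
  exists e, [/\ e != 0, maxid (exc_point i A u v l) e & C e^-1].
Proof.
have sD := chart_subring A u; have sD' := chart_subring A v.
move=> eC nC; exists (z - i l).
have my : maxid (exc_point i A u v l) (z - i l).
  by apply: (loc_maxidW sD (point_prime rA l)); apply: point_y.
have y0 : z - i l != 0.
  apply/eqP => y0; apply: (slope_nexc rA (l := l)); rewrite y0.
  exact: prime0 (exc_prime rA).
split=> //; case: (exceptional_cases eC) => [->|[l' e]|->].
- have [Dy ny] := exc_val_y rA l.
  by have [] := nmaxid (exc_val_chart rA Dy) ny.
- have pp := point_prime rA l'; rewrite e -div1r; apply: locI => //.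
  + exact: (subring1 sD).
  + by have [] := exc_val_y rA l.
  move=> h; apply: nC; rewrite e; congr exc_point.
  apply/eqP; rewrite eq_sym -subr_eq0; apply/eqP; apply: (point_const rA (l := l')).
  rewrite rmorphB (_ : _ - _ = (z - i l') - (z - i l)); last by ring.
  by apply: (primeB sD pp) => //; apply: point_y.
have pp := point_prime rA' 0; have Dw : D' w by exact: (chart_slope rA').
have qw : point_ideal i A v u 0 w by have := point_y i A v u 0; rewrite rmorph0 subr0.
have Dl : D' (i l * w) by apply: (subringM sD') => //; exact: (chartW (reg_const rA l)).
have n1 : ~ point_ideal i A v u 0 (1 - i l * w).
  move=> h; apply: (prime1 pp); rewrite -(subrK (i l * w) 1); apply: (primeD pp) => //.
  by apply: (primeM pp) => //; exact: (chartW (reg_const rA l)).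
rewrite (_ : (z - i l)^-1 = w / (1 - i l * w)).
  by apply: locI => //; apply: (subringB sD') => //; apply: (subring1 sD').
have n0 := nprime_neq0 pp n1.
apply: (mulfI y0); rewrite mulfV // (_ : z - i l = (1 - i l * w) / w); first field.
  by rewrite n0 (slope_neq0 rA').
by rewrite -(slope_inv v u); field; rewrite (slope_neq0 rA').
Qed.

End TwoCharts.

(* The blow-up of a point of a smooth branch V = (e = 0), with f a local
   coordinate on that branch, has exactly one point on the strict transform. *)
Section StrictTransform.
Variables (B V : set F) (e f : F).
Hypotheses (rB : regular i B e f) (lV : local_ring V) (BV : B `<=` V).
Hypotheses (me : maxid V e) (nf : ~ maxid V f).
Let rB' := reg_sym rB.
Let sV := lV.1.
Let Vif : V f^-1. Proof. by have [] := nmaxid (BV (reg_v rB)) nf. Qed.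
Let e0 := reg_neq0 rB.
Let f0 := reg_neq0r rB.
Local Notation C := (exc_point i B f e 0).

Lemma strict_slope : maxid V (slope f e).
Proof. by rewrite /slope; apply: (maxidMr sV). Qed.

Lemma strict_slopeV : ~ V (slope e f).
Proof.
move=> Vfe; apply: nf; rewrite (slopeE rB); exact: (maxidMr sV).
Qed.

(** In the chart of f the generator e / f lies in [maxid V], so the chart ring is contained in B +
    [maxid V]. It remains to invert denominators there. *)
Lemma strict_sub_plus : C `<=` plus_maxid V B.
Proof.
have sB := reg_subring rB; have sBV := plus_maxid_subring lV sB BV.
have BBV : B `<=` plus_maxid V B.
  by move=> x Bx; rewrite -[x]addr0; apply: plus_maxidI => //; apply: (maxid0 sV).
have BVV : plus_maxid V B `<=` V.
  by move=> _ [b Bb [m mm <-]]; apply: (subringD sV); [exact: BV|exact: maxidW].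
have DBV : blowup_chart B f `<=` plus_maxid V B.
  apply: (reg_chart_sub rB') => //.
  rewrite -[slope _ _]add0r; apply: plus_maxidI; first exact: (subring0 sB).
  exact: strict_slope.
move=> x /(locE (point_prime rB' 0))[a [b [Da Db nb b0 ->]]].
apply: (subringM sBV); first exact: DBV.
have [c [s [t [Ds Dt e1]]]] := chart_residue rB' 0 Db.
have c0 : c != 0.
  by apply/eqP => c0; apply: nb; exists s, t; split=> //; rewrite -e1 c0 rmorph0 subr0.
(* Modulo [maxid V] the denominator b equals c + s' f, a unit of B because c is nonzero and f lies
   in the maximal ideal of B. *)
have [s' Bs' [m mm es]] := DBV _ Ds.
have Bcf : B (i c + s' * f).
  by apply: (subringD sB); [exact: (reg_const rB)|apply: (subringM sB) => //; exact: (reg_v rB)].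
have nB : ~ maxid B (i c + s' * f).
  move=> mB; have mf : maxid B (s' * f) by apply: (maxidM sB) => //; exact: (reg_maxid_v rB).
  have := maxidB (reg_local rB) mB mf; rewrite addrK => /(maxid_const rB).
  by apply/eqP.
have [cf0 Bicf] := nmaxid Bcf nB.
have nV : ~ maxid V (i c + s' * f) by apply: maxid_inv => //; exact: BV.
have mrest : maxid V (b - (i c + s' * f)).
  have -> : b - (i c + s' * f) = m * f + t * slope f e.
    apply/eqP; rewrite -subr_eq0; apply/eqP.
    have -> : b - (i c + s' * f) - (m * f + t * slope f e) =
      (b - i c) - ((s' + m) * f + t * slope f e) by ring.
    by rewrite e1 es rmorph0 subr0 subrr.
  apply: lV.2; first by apply: (maxidMr sV) => //; apply: BV; exact: (reg_v rB).
  by apply: (maxidM sV); [exact: (BVV _ (DBV _ Dt))|exact: strict_slope].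
have Vb : V b := BVV _ (DBV _ Db).
have nVb : ~ maxid V b.
  by rewrite -(subrK (i c + s' * f) b) addrC; apply: local_addr_unit.
have [_ Vib] := nmaxid Vb nVb.
have -> : b^-1 = (i c + s' * f)^-1 +
   (- (b^-1 * (i c + s' * f)^-1)) * (b - (i c + s' * f)) by field; rewrite b0 cf0.
apply: plus_maxidI => //; apply: (maxidM sV) => //.
by apply: (subringN sV); apply: (subringM sV) => //; apply: BV.
Qed.

Lemma strict_sub : C `<=` V.
Proof.
by move=> x /strict_sub_plus[b Bb [m mm <-]]; apply: (subringD sV); [exact: BV|exact: maxidW].
Qed.

Lemma strict_plus : plus_maxid V C = plus_maxid V B.
Proof.
apply/seteqP; split=> _ [x hx [m mm <-]]; last first.
  apply: plus_maxidI => //; apply: (locW (chart_subring B f) (point_prime rB' 0)).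
  exact: chartW.
have [b Bb [n mn <-]] := strict_sub_plus hx.
by rewrite -addrA; apply: plus_maxidI => //; apply: lV.2.
Qed.

(** At every other point of the exceptional curve f / e is regular, but it is not in V, since e
    vanishes on the branch and f does not. *)
Lemma strict_unique C' : exceptional_points B C' -> C' `<=` V -> C' = C.
Proof.
move=> eC' C'V; case: (exceptional_cases rB' eC') => [h|[l h]|h].
- exfalso; apply: strict_slopeV; apply: C'V; rewrite h.
  by have := exc_val_slopeV rB'; rewrite slope_inv.
- have [l0|l0] := eqVneq l 0; first by rewrite h l0.
  exfalso; apply: strict_slopeV; apply: C'V; rewrite h -slope_inv -div1r.
  apply: locI; [exact: (subring1 (chart_subring B f))|exact: (chart_slope rB')|].
  move=> hs; apply/negP: l0; rewrite negbK; apply/eqP.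
  apply: (point_const rB' (l := l)).
  rewrite (_ : i l = slope f e - (slope f e - i l)); last by ring.
  apply: (primeB (chart_subring B f) (point_prime rB' l)) => //; exact: point_y.
exfalso; apply: strict_slopeV; apply: C'V; rewrite h.
apply: (locW (chart_subring B e) (point_prime rB 0)); exact: (chart_slope rB).
Qed.

End StrictTransform.
End BlowupPoints.

(** * Poles along the tower *)

Section Poles.
Local Open Scope classical_set_scope.
Local Open Scope ring_scope.
Variables (F : fieldType) (k : closedFieldType) (i : {rmorphism k -> F}).
Implicit Types (A B C D T V q : set F) (a b x g r : F) (P : {poly k}).

Definition pole1 B v r := exists n g, B g /\ r = g / v ^+ n.

(** For a subring B, the ideal is all of B if n or m is 0, so both exponents are positive. *)
Definition pole2 B u v r := exists n m g,
  [/\ B g, ~ ideal2 B (u ^+ n) (v ^+ m) g & r = g / (u ^+ n * v ^+ m)].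

(* The crucial invariant: wherever r has poles along two branches u = 0 and
   v = 0 through a point, r tends to infinity along all the divisors over that
   point lying between them; this is the condition on ideal2 in pole2. *)
Definition tame B r :=
  exists u v, regular i B u v /\ (pole1 B v r \/ pole2 B u v r).

Lemma maxid_pow_swap B u v n x : maxid_pow B u v n x -> maxid_pow B v u n x.
Proof.
elim: n x => [|n IH] x //= [a [b [/IH ha /IH hb ->]]].
by exists b, a; split=> //; rewrite addrC.
Qed.

Lemma pole2_sym B u v r : pole2 B u v r -> pole2 B v u r.
Proof.
move=> [n [m [g [Bg ng ->]]]]; exists m, n, g; split=> //.
  by move=> [a [b [Ba Bb e]]]; apply: ng; exists b, a; split=> //; rewrite e addrC.
by rewrite [v ^+ m * _]mulrC.
Qed.

Lemma slopeX A u v n : regular i A u v -> v ^+ n = u ^+ n * slope u v ^+ n.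
Proof. by move=> rA; rewrite -exprMn -(slopeE rA). Qed.

Section OnePoint.
Variables (A : set F) (u v : F).
Hypothesis rA : regular i A u v.
Local Notation D := (blowup_chart A u).
Local Notation z := (slope u v).
Local Notation V := (exc_valuation A u).
Local Notation pt := (exc_point i A u v).
Let u0 := reg_neq0 rA.
Let v0 := reg_neq0r rA.
Let z0 := slope_neq0 rA.
Let sA := reg_subring rA.
Let sD := chart_subring A u.

Let sC l : subring (pt l). Proof. exact: loc_subring sD (point_prime rA l). Qed.
Let DC l : D `<=` pt l.
Proof. by move=> x; apply: (locW sD (point_prime rA l)). Qed.
Let AC l : A `<=` pt l. Proof. by move=> x Ax; apply: DC; apply: chartW. Qed.
Let Cz l : pt l z. Proof. by apply: DC; apply: (chart_slope rA). Qed.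
Let Cu l : pt l u. Proof. by apply: AC; apply: (reg_u rA). Qed.

Lemma exc_point0_regular : regular i (pt 0) u z.
Proof. by have := exc_point_regular rA 0; rewrite rmorph0 subr0. Qed.

Let rC := exc_point0_regular.

(* This is what makes pole2 persist at the satellite point (u, z): comparing
   initial forms degree by degree, all terms of g of degree less than N are
   divisible by v^m. *)
Lemma contract_ideal N m g : A g -> ideal2 (pt 0) (u ^+ N) (z ^+ m) g ->
  exists b h, [/\ A b, maxid_pow A u v N h & g = b * v ^+ m + h].
Proof.
move=> Ag [s [t [Cs Ct gE]]].
suff : forall n, (n <= N)%N -> exists b h, [/\ A b, maxid_pow A u v n h & g = b * v ^+ m + h].
  by apply.
elim=> [|n IH] ltnN.
  by exists 0, g; split=> //; [exact: (subring0 sA)|ring].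
have [b [h [Ab hh gE']]] := IH (ltnW ltnN).
have [P [h' [sP hh' hE]]] := maxid_pow_form rA hh.
have [d' Dd' h'E] := maxid_pow_chart rA hh'.
(* The terms of degree at least m in z will be absorbed into the multiple of v^m; [poly_pow_ideal]
   at the point (u, z) kills the others. *)
pose lo := take_poly m P; pose hi := drop_poly m P.
have PE : P = lo + hi * 'X^m by rewrite /lo /hi poly_take_drop.
have lo0 : lo = 0.
  apply: (poly_pow_ideal rC (n := n) (size_take_poly m P)).
  (* The low part is isolated from g = b v^m + u^n P(z) + u^(n+1) d', using g = s u^N + t z^m and v
     = u z. *)
  exists (s * u ^+ (N - n.+1) - d'), (t - b * u ^+ m - u ^+ n * peval i hi z); split.
  - apply: (subringB (sC 0)); last exact: DC.
    by apply: (subringM (sC 0)) => //; apply: (subringX _ (sC 0)).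
  - apply: (subringB (sC 0)).
      apply: (subringB (sC 0)) => //; apply: (subringM (sC 0)); first exact: AC.
      exact: (subringX _ (sC 0)).
    apply: (subringM (sC 0)); first exact: (subringX _ (sC 0)).
    by apply: (peval_subring _ (sC 0)) => // c; apply: AC; apply: (reg_const rA).
  have loE : u ^+ n * peval i lo z =
      g - b * v ^+ m - u ^+ n.+1 * d' - u ^+ n * peval i hi z * z ^+ m.
    by rewrite gE' hE h'E [in peval i P z]PE pevalD pevalM pevalXn; ring.
  have uN : u ^+ N = u ^+ (N - n.+1) * u ^+ n.+1 by rewrite -exprD subnK.
  by rewrite -/lo loE gE uN (slopeX _ rA); ring.
have [lemn|ltnm] := leqP m n; last first.
  exists b, h'; split=> //; rewrite gE' hE PE lo0.
  have -> : hi = 0 by apply: drop_poly_eq0; apply: leq_trans sP _.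
  by rewrite mul0r addr0 peval0; ring.
(* As hi has degree at most n - m, the first factor of u^n hi(z) z^m = (u^(n-m) hi(z)) v^m lies in
   A. *)
have hhi : maxid_pow A u v (n - m) (u ^+ (n - m) * peval i hi z).
  by apply: (form_maxid_pow rA); rewrite size_drop_poly leq_subLR addnS subnKC.
exists (b + u ^+ (n - m) * peval i hi z), h'; split=> //.
  by apply: (subringD sA) => //; apply: (maxid_pow_sub rA hhi).
have un : u ^+ n = u ^+ (n - m) * u ^+ m by rewrite -exprD subnK.
rewrite gE' hE PE lo0 add0r pevalM pevalXn un (slopeX _ rA); ring.
Qed.

(** With n the (u, v)-adic order of g, the initial form is u^n P(z) with P nonzero, and P(z) is a
    unit of V because z is transcendental modulo [maxid V]. *)
Lemma exc_val_factor N g : A g -> ~ maxid_pow A u v N g ->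
  exists n e, [/\ (n < N)%N, V e, ~ maxid V e & g = u ^+ n * e].
Proof.
move=> Ag; elim: N => [|N IH] // ng.
have [hg|/IH[n [e [lt Ve ne ge]]]] := pselect (maxid_pow A u v N g); last first.
  by exists n, e; split=> //; apply: ltnW.
have [P [h [sP hh gE]]] := maxid_pow_form rA hg.
have [d Dd hE] := maxid_pow_chart rA hh.
have P0 : P != 0.
  by apply/eqP => P0; apply: ng; rewrite gE P0 peval0 mulr0 add0r.
have DV := exc_val_chart rA; have [sV lV] := exc_val_local rA.
have VP : V (peval i P z).
  apply: DV; apply: (peval_subring P sD) => [c|]; last exact: (chart_slope rA).
  by apply: chartW; apply: (reg_const rA).
have mud : maxid V (u * d) by apply: (maxidMr sV); [exact: DV|exact: (exc_val_u rA)].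
exists N, (peval i P z + u * d); split=> //.
- by apply: (subringD sV) => //; apply: maxidW.
- apply: (local_addr_unit (exc_val_local rA)) => //.
  by move=> /(exc_val_poly rA)/eqP; apply/negP.
by rewrite gE hE exprSr; ring.
Qed.

Lemma pole_free l n m g : l != 0 -> A g -> pole1 (pt l) u (g / (u ^+ n * z ^+ m)).
Proof.
move=> l0 Ag; exists n, (g / z ^+ m); split; last by field; rewrite !expf_neq0.
apply: (subringM (sC l)); first exact: AC.
rewrite -exprVn; apply: (subringX _ (sC l)); rewrite -div1r; apply: locI.
- exact: (subring1 sD).
- exact: (chart_slope rA).
move=> hz; apply/negP: l0; rewrite negbK; apply/eqP; apply: (point_const rA (l := l)).
rewrite (_ : i l = z - (z - i l)); last by ring.
by apply: (primeB sD (point_prime rA l)) => //; apply: point_y.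
Qed.

Lemma tame_free l n m g : l != 0 -> A g -> tame (pt l) (g / (u ^+ n * z ^+ m)).
Proof.
move=> l0 Ag; exists (z - i l), u; split; last by left; apply: pole_free.
exact: reg_sym (exc_point_regular rA l).
Qed.

(** Since v = u z, the exponents (n, m) become (n + m, m) at z = 0. If g fell into (u^(n+m), z^m)
    there, it would be a multiple of v^m up to an element of (u, v)^(n+m), and that power is
    contained in (u^n, v^m). *)
Lemma pole2_point l r : pole2 A u v r -> tame (pt l) r.
Proof.
move=> [n [m [g [Ag ng rE]]]].
have rE' : r = g / (u ^+ (n + m) * z ^+ m).
  by rewrite rE (slopeX _ rA) exprD mulrA.
have [l0|l0] := eqVneq l 0; last by rewrite rE'; apply: tame_free.
rewrite l0; exists u, z; split=> //; right; exists (n + m)%N, m, g.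
split=> //; first exact: AC.
move=> /(contract_ideal Ag)[b [h [Ab /(maxid_pow_ideal2 rA)[s [t [As At hE]]] gE]]].
apply: ng; exists s, (b + t); split=> //; first exact: (subringD sA).
by rewrite gE hE; ring.
Qed.

(** At z = 0 both shapes can occur. If g lies in (u^n, z^n), then g = b v^n + u^n d and r = (b z^n +
    d) / z^n has poles along the strict transform only; otherwise r has the second shape with equal
    exponents. *)
Lemma pole1_point l r : pole1 A v r -> tame (pt l) r.
Proof.
move=> [n [g [Ag rE]]].
have rE' : r = g / (u ^+ n * z ^+ n) by rewrite rE (slopeX _ rA).
have [l0|l0] := eqVneq l 0; last by rewrite rE'; apply: tame_free.
rewrite l0; exists u, z; split=> //.
have [h|h] := pselect (ideal2 (pt 0) (u ^+ n) (z ^+ n) g); last first.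
  by right; exists n, n, g; split=> //; apply: AC.
left; have [b [h' [Ab hh gE]]] := contract_ideal Ag h.
have [d Dd hE] := maxid_pow_chart rA hh.
exists n, (b * z ^+ n + d); split.
  apply: (subringD (sC 0)); last exact: DC.
  by apply: (subringM (sC 0)); [exact: AC|apply: (subringX _ (sC 0))].
rewrite rE' gE hE (slopeX _ rA); field.
by rewrite !expf_neq0.
Qed.

(** The point v / u = 0 is off the strict transform of u = 0, so there u = 0 is the exceptional
    curve alone. *)
Lemma pole1_tangent r : pole1 A u r -> tame (pt 0) r.
Proof.
move=> [n [g [Ag rE]]]; exists z, u; split; first exact: reg_sym.
by left; exists n, g; split=> //; apply: AC.
Qed.

(** The inverse is u^(N-n) z^m / e, where n < N is the order of g and e is a unit of V. *)
Lemma exc_val_pole N m g : A g -> ~ maxid_pow A u v N g ->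
  maxid V (g / (u ^+ N * z ^+ m))^-1.
Proof.
move=> Ag /(exc_val_factor Ag)[n [e [ltnN Ve ne gE]]].
have [sV lV] := exc_val_local rA; have [e0 Vie] := nmaxid Ve ne.
have Vz : V z by apply: (exc_val_chart rA); apply: (chart_slope rA).
have Vu : V u := maxidW (exc_val_u rA).
have uN : u ^+ N = u ^+ n * (u ^+ (N - n).-1 * u).
  by rewrite -exprSr prednK ?subn_gt0 // -exprD subnKC // ltnW.
have -> : (g / (u ^+ N * z ^+ m))^-1 = (u ^+ (N - n).-1 * z ^+ m * e^-1) * u.
  by rewrite gE uN; field; rewrite !expf_neq0 ?e0 ?u0 ?z0.
apply: (maxidM sV); last exact: (exc_val_u rA).
by apply: (subringM sV) => //; apply: (subringM sV); apply: (subringX _ sV).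
Qed.

End OnePoint.

Lemma tame_blowup A u v r C : regular i A u v -> pole1 A v r \/ pole2 A u v r ->
  exceptional_points A C -> C = exc_valuation A u \/ tame C r.
Proof.
move=> rA hr /(exceptional_cases rA)[->|[l ->]|->]; [by left|right|right].
  by case: hr => h; [apply: pole1_point|apply: pole2_point].
have rA' := reg_sym rA.
by case: hr => h; [apply: pole1_tangent|apply: pole2_point => //; apply: pole2_sym].
Qed.

Lemma tame_exc_val A u v r (V := exc_valuation A u) :
  regular i A u v -> pole1 A v r \/ pole2 A u v r ->
  maxid V r^-1 \/ exists Q : {poly k}, maxid V (r - peval i Q (slope v u)).
Proof.
move=> rA [[n [g [Ag rE]]]|[n [m [g [Ag ng rE]]]]].
  have [hg|ng] := pselect (maxid_pow A u v n g); last first.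
    by left; rewrite rE (slopeX _ rA); apply: exc_val_pole.
  (* In the chart of v the denominator v^n cancels, as g lies in (u, v)^n; hence the coordinate u /
     v. *)
  right; have rA' := reg_sym rA; rewrite /V (exc_val_swap rA).
  have [d Dd gE] := maxid_pow_chart rA' (maxid_pow_swap hg).
  have -> : r = d by rewrite rE gE mulrAC mulfV ?mul1r // expf_neq0 // (reg_neq0r rA).
  have [P [d' [Dd' ->]]] := chart_dec rA' Dd.
  exists P; rewrite addrC addKr; have [sV _] := exc_val_local rA'.
  by apply: (maxidMr sV); [exact: (exc_val_chart rA')|exact: (exc_val_u rA')].
left; rewrite rE.
have -> : g / (u ^+ n * v ^+ m) = g / (u ^+ (n + m) * (slope u v) ^+ m).
  by rewrite (slopeX _ rA) exprD mulrA.
by apply: exc_val_pole => // /(maxid_pow_ideal2 rA).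
Qed.

End Poles.

(** * Towers of blow-ups *)

Section Towers.
Local Open Scope classical_set_scope.
Local Open Scope ring_scope.
Variables (F : fieldType) (k : closedFieldType) (i : {rmorphism k -> F}).
Implicit Types (A B C D T V W q : set F) (S : set (set F)) (a b x g : F) (P : {poly k}).

(** The maximal ideal of V is uV. Parameters e = u a and f = u b satisfy a f = b e, so a = d e = d u
    a and 1 = d u, which is absurd. Hence the generic point of an exceptional curve is never
    tame. *)
Lemma exc_val_not_regular A u v e f :
  regular i A u v -> ~ regular i (exc_valuation A u) e f.
Proof.
move=> rA rV; set V := exc_valuation A u in rV.
have [sV _] := exc_val_local rA; rewrite -/V in sV.
have uV x : maxid V x -> exists2 y, V y & x = u * y.
  move=> /(loc_maxid (exc_prime rA)).
  move=> [_ [b [[d Dd <-] Db nb b0 ->]]]; exists (d / b); last by rewrite mulrA.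
  exact: locI.
have [a Va eE] := uV _ (reg_maxid_u rV); have [b Vb fE] := uV _ (reg_maxid_v rV).
have e0 := reg_neq0 rV; case: (rV) => _ _ _ _ [_ h].
have [|d Vd aE] := h a b Va Vb; first by rewrite eE fE; ring.
have /eqP : a * (1 - u * d) = 0.
  have -> : a * (1 - u * d) = a - d * (u * a) by ring.
  by rewrite -eE -aE subrr.
rewrite mulf_eq0 => /orP[/eqP a0|/eqP h1]; first by rewrite eE a0 mulr0 eqxx in e0.
apply: (maxid1 sV); rewrite -(subrK (u * d) 1) h1 add0r.
by apply: (maxidMr sV) => //; apply: (exc_val_u rA).
Qed.

Variables (R : set F) (r : F).

Definition tame_point B := dominates B R /\ tame i B r.

Definition off_fibre W := exists e, [/\ maxid R e, e != 0 & W e^-1].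

(** Near B the curve is e = 0, with f as a local coordinate on it: the input of the strict
    transform. *)
Definition smooth_at V B :=
  exists e f, [/\ regular i B e f, maxid V e & ~ maxid V f].

(** Smoothness at tame points controls the points of the curve when one of them is blown up. The
    last clause gives V a tame specialization, so that a closed point chosen as a centre cannot
    escape being tame. *)
Definition good_curve S V :=
  [/\ local_ring V, dominates V R,
      exists z, affine_coordinate i S V z /\
        (maxid V r^-1 \/ exists Q : {poly k}, maxid V (r - peval i Q z)),
      forall B, S B -> tame_point B -> B `<=` V -> smooth_at V B
    & exists B, [/\ S B, tame_point B & B `<=` V]].

(** In the spirit of the valuative criterion: no ring containing W dominates A ([separated_sub]), so
    no old point lies on a new exceptional curve. The explicit function e is what passes through
    blow-ups. *)
Definition separated S := forall A W, S A -> tame_point A -> S W -> W <> A ->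
  exists e, [/\ e != 0, maxid A e & W e^-1].

Definition tame_model S :=
  (forall W, S W -> [\/ off_fibre W, tame_point W | good_curve S W]) /\ separated S.

(** This keeps a tame point from being the generic point of a component of the fibre. *)
Definition covered S B := exists V, [/\ S V, good_curve S V & B `<=` V].

Lemma off_fibre_dominates W : off_fibre W -> ~ dominates W R.
Proof. by move=> [e [me e0 We]] [_ /(_ _ me)]; apply: maxid_inv. Qed.

Lemma good_curve_not_tame S V : S V -> good_curve S V -> ~ tame_point V.
Proof.
by move=> SV [_ _ _ h _] cV; have [//|e [f [rV _]]] := h V SV cV; apply; apply: (reg_maxid_v rV).
Qed.

Lemma separated_sub S A W X : separated S -> S A -> tame_point A -> S W -> W <> A ->
  dominates X A -> ~ W `<=` X.
Proof.
move=> sS SA cA SW WA [AX mAX] WX; have [e [e0 me We]] := sS _ _ SA cA SW WA.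
exact: maxid_inv e0 (WX _ We) (mAX _ me).
Qed.

(** * The effect of one blow-up on the invariants *)

Section BlowupStep.
Variables (S : set (set F)) (A : set F) (u v : F).
Hypotheses (tS : tame_model S) (SA : S A) (dA : dominates A R) (rA : regular i A u v).
Hypothesis hr : pole1 A v r \/ pole2 A u v r.
Local Notation S' := (blowup S A).
Local Notation V0 := (exc_valuation A u).
Let cA : tame_point A. Proof. by split=> //; exists u, v. Qed.
Let rA' := reg_sym rA.
Let sepS : separated S := tS.2.

Lemma exceptional_dominates_base C : exceptional_points A C -> dominates C R.
Proof. by move=> /exceptional_dominates dC; apply: dominates_trans dC dA. Qed.

Lemma exceptional_tame C : exceptional_points A C -> C = V0 \/ tame_point C.
Proof.
move=> eC; have [->|tC] := tame_blowup rA hr eC; first by left.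
by right; split=> //; apply: exceptional_dominates_base.
Qed.

Lemma exceptional_regular_tame C e f :
  exceptional_points A C -> regular i C e f -> tame_point C.
Proof.
by move=> /exceptional_tame[->|//] /(exc_val_not_regular rA).
Qed.

Lemma tame_exceptional C : tame_point C -> exceptional_points A C ->
  (exists l, C = exc_point i A u v l) \/ C = exc_point i A v u 0.
Proof.
move=> [_ [e [f [rC _]]]] /(exceptional_cases rA)[CV|h|h]; [|by left|by right].
by case: (exc_val_not_regular rA (e := e) (f := f)); rewrite -CV.
Qed.

Lemma blowup_sub_val B : S' B /\ B `<=` V0 <-> exceptional_points A B.
Proof.
split=> [[[[SB BA]|//] BV]|eB].
  exfalso; exact: (separated_sub sepS SA cA SB BA (exc_val_dominates rA)).
by split; [right|apply: (exceptional_sub_val rA)].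
Qed.

Lemma new_closure_points : closure_points S' V0 =
  affine_line i V0 (slope v u) `|` affine_line i V0 (slope v u)^-1.
Proof.
have := exceptional_closure rA'; rewrite -(exc_val_swap rA) => <-.
apply/seteqP; split=> _ [B hB <-]; exists B => //.
  by apply/blowup_sub_val.
by apply/blowup_sub_val.
Qed.

Lemma new_good_curve : good_curve S' V0.
Proof.
split.
- exact: (exc_val_local rA).
- by apply: exceptional_dominates_base; apply: (exc_val_exceptional rA).
(* The coordinate u / v, rather than v / u, sends the branch v = 0, where a nonconstant r may have
   its pole, to infinity. *)
- exists (slope v u); split; last exact: tame_exc_val.
  split; last exact: new_closure_points.
    by have := exc_val_slopeV rA; rewrite slope_inv.
  by move=> P P0; rewrite (exc_val_swap rA) => /(exc_val_poly rA')/eqP; apply/negP.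
- move=> B SB cB BV; have eB := (blowup_sub_val B).1 (conj SB BV).
  have [[l ->]|->] := tame_exceptional cB eB.
    exists u, (slope u v - i l); split; first exact: exc_point_regular.
      exact: (exc_val_u rA).
    by have [] := exc_val_y rA l.
  exists v, (slope v u - i 0); rewrite (exc_val_swap rA).
  split; first exact: exc_point_regular.
    exact: (exc_val_u rA').
  by have [] := exc_val_y rA' 0.
have eB := exc_point_exceptional rA 0.
exists (exc_point i A u v 0); split; first by right.
  exact: exceptional_regular_tame eB (exc_point_regular rA 0).
exact: (exc_point_val rA).
Qed.

Lemma old_good_curve V : S V -> good_curve S V -> good_curve S' V.
Proof.
move=> SV gV; have [lV dV [z [[Vz ztr clS] rz]] sm [B0 [SB0 cB0 B0V]]] := gV.
have AB C x : exceptional_points A C -> A x -> C x by move=> /exceptional_dominates[h _] /h.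
(* A curve through A has exactly one point over A, with the same local ring on the curve, and is
   smooth there again. *)
have strict : A `<=` V -> exists C, [/\ exceptional_points A C, tame_point C, C `<=` V,
    plus_maxid V C = plus_maxid V A
    & smooth_at V C /\ forall C', exceptional_points A C' -> C' `<=` V -> C' = C].
  move=> AV; have [e [f [rAe me nf]]] := sm A SA cA AV.
  have eC := exc_point_exceptional (reg_sym rAe) 0.
  have rC : regular i (exc_point i A f e 0) f (slope f e).
    by have := exc_point_regular (reg_sym rAe) 0; rewrite rmorph0 subr0.
  exists (exc_point i A f e 0); split.
  - by [].
  - exact: exceptional_regular_tame eC rC.
  - exact: (strict_sub rAe).
  - exact: (strict_plus rAe).
  split; first by exists (slope f e), f; split=> //; [exact: reg_sym|exact: (strict_slope rAe lV AV me nf)].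
  by move=> C' eC' C'V; apply: (strict_unique rAe lV me nf).
split=> //.
- exists z; split=> //; split=> //; rewrite -clS.
  apply/seteqP; split=> _ [B [SB BV] <-].
    case: SB => [[SB BA]|eB]; first by exists B.
    have AV : A `<=` V by move=> x /(AB _ _ eB)/BV.
    have [C [eC cC CV pC [_ uC]]] := strict AV.
    by exists A => //; rewrite (uC _ eB BV); exact: esym pC.
  have [BA|BA] := pselect (B = A); last by exists B => //; split=> //; left.
  rewrite BA in BV *; have [C [eC cC CV pC _]] := strict BV.
  by exists C => //; split=> //; right.
- move=> B [[SB BA]|eB] cB BV; first exact: sm.
  have AV : A `<=` V by move=> x /(AB _ _ eB)/BV.
  by have [C [_ _ _ _ [sC uC]]] := strict AV; rewrite (uC _ eB BV).
have [B0A|B0A] := pselect (B0 = A); last by exists B0; split=> //; left.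
rewrite B0A in B0V; have [C [eC cC CV _ _]] := strict B0V.
by exists C; split=> //; right.
Qed.

(** A function separating A from an old point serves for the points over A, which dominate A; two
    points over A are separated by the coordinate of the exceptional curve. *)
Lemma blowup_separated : separated S'.
Proof.
move=> B W [[SB BA]|eB] cB [[SW WA]|eW] WB.
- exact: sepS.
- have [e [e0 me Ae]] := sepS SB cB SA (nesym BA).
  by exists e; split=> //; apply: (exceptional_dominates eW).1.
- have [e [e0 me We]] := sepS SA cA SW WA.
  by exists e; split=> //; apply: (exceptional_dominates eB).2.
have [[l e]|e] := tame_exceptional cB eB; rewrite e in WB *.
  exact: (exc_point_separated rA).
exact: (exc_point_separated rA').
Qed.

Lemma blowup_tame_model : tame_model S'.
Proof.
split; last exact: blowup_separated.
move=> W [[SW WA]|eW].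
  have [h|h|h] := tS.1 W SW; [by constructor 1|by constructor 2|constructor 3].
  exact: old_good_curve.
have [->|h] := exceptional_tame eW; [constructor 3|by constructor 2].
exact: new_good_curve.
Qed.

(** The centre is excluded from the hypothesis because at the first blow-up it is R, the only tame
    point of [spec R], which lies on no good curve there. *)
Lemma blowup_covered :
  (forall B, S B -> B <> A -> tame_point B -> covered S B) ->
  forall B, S' B -> tame_point B -> covered S' B.
Proof.
move=> h B [[SB BA]|eB] cB.
  have [V [SV gV BV]] := h B SB BA cB; exists V; split=> //; last exact: old_good_curve.
  by left; split=> // VA; apply: (good_curve_not_tame SV gV); rewrite VA.
exists V0; split; [|exact: new_good_curve|exact: (exceptional_sub_val rA)].
by right; apply: (exc_val_exceptional rA).
Qed.

End BlowupStep.

(** A prime containing [maxid R] gives back R; otherwise an element of [maxid R] outside the prime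
    becomes invertible. *)
Lemma spec_cases W : local_ring R -> spec R W -> W = R \/ off_fibre W.
Proof.
move=> [sR lR] [q pq <-].
have [[e [me nqe]]|h] := pselect (exists e, maxid R e /\ ~ q e).
  right; exists e; split=> //; first exact: (nprime_neq0 pq nqe).
  by rewrite -div1r; apply: locI => //; [exact: (subring1 sR)|exact: maxidW].
left; apply/seteqP; split=> x; last by apply: locW.
move=> /(locE pq)[a [b [Ra Rb nb b0 ->]]]; apply: (subringM sR) => //.
have nmb : ~ maxid R b by move=> mb; apply: h; exists b.
by have [] := nmaxid Rb nmb.
Qed.

Lemma spec_self : local_ring R -> spec R R.
Proof.
move=> lR; have [sR _] := lR; exists (maxid R `&` R).
  by apply: maxid_prime.
apply/seteqP; split=> x.
  move=> [a Ra [b [Rb nb] <-]]; apply: (subringM sR) => //.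
  have nmb : ~ maxid R b by move=> mb; apply: nb.
  by have [] := nmaxid Rb nmb.
apply: locW => //; exact: maxid_prime.
Qed.

Hypothesis tR : tame i R r.

Lemma tower_tame_model S : blowup_tower R S ->
  tame_model S /\ forall B, S B -> tame_point B -> covered S B.
Proof.
have cR : tame_point R by split=> //; exact: dominates_refl.
elim=> [|{}S A hS [tS cS] [SA clA] dA].
  have [u [v [rR hr]]] := tR; have lR := reg_local rR.
  have RR := spec_self lR.
  have sp W : spec R W -> tame_point W -> W = R.
    by move=> /(spec_cases lR)[//|/off_fibre_dominates nd] [].
  have tR0 : tame_model (spec R).
    split=> [W /(spec_cases lR)[->|]|B W SB cB SW]; [by constructor 2|by constructor 1|].
    rewrite (sp _ SB cB) => WR; have [//|[e [me e0 We]]] := spec_cases lR SW.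
    by exists e.
  split; first exact: (blowup_tame_model tR0 RR (dominates_refl _) rR hr).
  apply: (blowup_covered tR0 RR (dominates_refl _) rR hr) => B SB BR cB.
  by case: BR; apply: sp.
(* The centre dominates R, hence is not off the fibre; if it were a good curve, being closed it
   would equal its own tame specialization. *)
have [_ [u [v [rA hr]]]] : tame_point A.
  have [/off_fibre_dominates//|//|gA] := tS.1 A SA.
  have [_ _ _ _ [B [SB cB BA]]] := gA.
  by rewrite -(clA B SB BA).
split; first exact: (blowup_tame_model tS SA dA rA hr).
apply: (blowup_covered tS SA dA rA hr) => B SB _; exact: cS.
Qed.

Lemma fibre_component_polynomial S V : blowup_tower R S -> fibre_component R S V ->
  ~ constant_on i V r ->
  exists z (Q : {poly k}), affine_coordinate i S V z /\ maxid V (r - peval i Q z).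
Proof.
move=> /tower_tame_model[tS cS] [SV dV maxV] ncV.
have [/off_fibre_dominates//|cV|] := tS.1 V SV.
  (* A tame V would lie on a good curve W; maximality gives W = V, but a good curve is not tame. *)
  have [W [SW gW VW]] := cS V SV cV.
  have [_ dW _ _ _] := gW.
  case: (good_curve_not_tame SW gW); rewrite (maxV W) //.
move=> [_ _ [z [zc [m|[Q hQ]]]] _ _]; first by case: ncV; left.
by exists z, Q.
Qed.

End Towers.

(** * Power series *)

Section PowerSeries.
Local Open Scope ring_scope.
Variable A : comUnitRingType.
Implicit Types (f g h : fps A) (a : A).

Lemma fcoefD f g n : fcoef (f + g) n = fcoef f n + fcoef g n. Proof. by []. Qed.
Lemma fcoefN f n : fcoef (- f) n = - fcoef f n. Proof. by []. Qed.
Lemma fcoefM f g n : fcoef (f * g) n = \sum_(j < n.+1) fcoef f j * fcoef g (n - j)%N.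
Proof. by []. Qed.

Lemma fcoefM0 f g : fcoef (f * g) 0 = fcoef f 0 * fcoef g 0.
Proof. by rewrite fcoefM big_ord1. Qed.

Lemma fcoefMC f a n : fcoef (f * fpsC a) n = fcoef f n * a.
Proof.
rewrite fcoefM big_ord_recr /= subnn big1 ?add0r // => j _.
by case: (n - j)%N (subn_gt0 j n) => [|m _]; rewrite ?ltn_ord //= mulr0.
Qed.

Lemma fcoefMX0 f : fcoef (f * fpsX) 0 = 0.
Proof. by rewrite fcoefM0 /= mulr0. Qed.

Lemma fcoefMXS f n : fcoef (f * fpsX) n.+1 = fcoef f n.
Proof.
rewrite fcoefM big_ord_recr /= subnn mulr0 addr0 big_ord_recr /= subSnn mulr1.
rewrite big1 ?add0r // => j _; rewrite subSn ?(ltnW (ltn_ord j)) // eqSS.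
by rewrite subn_eq0 leqNgt ltn_ord mulr0.
Qed.

Definition fps_shift f : fps A := Fps (fun n => fcoef f n.+1).

Lemma fps_shiftE f : f = fpsC (fcoef f 0) + fps_shift f * fpsX.
Proof.
apply: fpsP => -[|n]; rewrite fcoefD ?fcoefMX0 ?fcoefMXS /=; first by rewrite addr0.
by rewrite add0r.
Qed.

Lemma fcoef_expMX h m n : (n < m)%N -> fcoef ((h * fpsX) ^+ m) n = 0.
Proof.
elim: m n => // m IH n ltnm; rewrite exprSr mulrA.
case: n ltnm => [|n] ltnm; first by rewrite fcoefMX0.
rewrite fcoefMXS fcoefM big1 // => j _; rewrite IH ?mul0r //.
exact: leq_ltn_trans (leq_ord j) _.
Qed.

(** The inverse is the geometric series: (h X)^j contributes nothing below degree j, so the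
    coefficient of degree n is read off the partial sum of n + 1 terms. *)
Lemma fps_geometric h : exists g, (1 - h * fpsX) * g = 1.
Proof.
pose s N := \sum_(j < N) (h * fpsX) ^+ j.
have sS N n : (n < N)%N -> fcoef (s N.+1) n = fcoef (s N) n.
  by move=> lt; rewrite /s big_ord_recr fcoefD /= fcoef_expMX ?addr0.
have sE n N : (n < N)%N -> fcoef (s N) n = fcoef (s n.+1) n.
  elim: N => // N IH; rewrite ltnS leq_eqVlt => /orP[/eqP-> //|lt].
  by rewrite sS // IH.
exists (Fps (fun n => fcoef (s n.+1) n)); apply: fpsP => n.
have e : 1 = (1 - h * fpsX) * s n.+1 + (h * fpsX) ^+ n.+1.
  by rewrite -[X in _ + X](subrK 1) subrX1 -/(s _); ring.
rewrite [in RHS]e fcoefD fcoef_expMX // addr0 !fcoefM; apply: eq_bigr => j _.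
by congr (_ * _); rewrite /= [RHS]sE // ltnS leq_subr.
Qed.

Lemma fps_unitE f : (f \is a GRing.unit) = (fcoef f 0 \is a GRing.unit).
Proof.
apply/idP/idP => [/unitrPr[g fg]|uf].
  by apply/unitrPr; exists (fcoef g 0); rewrite -fcoefM0 fg.
have [g e] := fps_geometric (- (fpsC (fcoef f 0)^-1 * fps_shift f)).
apply/unitrPr; exists (fpsC (fcoef f 0)^-1 * g).
have aV : fpsC (fcoef f 0) * fpsC (fcoef f 0)^-1 = 1 by rewrite -rmorphM mulrV ?rmorph1.
rewrite -[RHS]e mulrA; congr (_ * _).
by rewrite mulNr opprK {1}[f]fps_shiftE mulrDl aV; ring.
Qed.

End PowerSeries.

(** * K[[x,y]] as a regular local ring *)

Section BaseRing.
Local Open Scope classical_set_scope.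
Local Open Scope ring_scope.
Variable K : fieldType.
Local Notation tofrac := (@FracField.tofrac {psxy K}).

Lemma psxy_unitE (f : {psxy K}) : (f \is a GRing.unit) = (fcoef (fcoef f 0) 0 != 0).
Proof. by rewrite !fps_unitE unitfE. Qed.

Lemma ringxy_maxid (f : {psxy K}) : maxid (ringxy (K := K)) (tofrac f) <-> f \isn't a GRing.unit.
Proof.
split=> [[_ nf]|nf].
  apply/negP => /unitrPr[g fg]; apply: nf; exists (tofrac g); split; first by exists g.
  by rewrite -rmorphM fg rmorph1.
split; first by exists f.
move=> [_ [[g _ <-] e]]; move/negP: nf; apply; apply/unitrPr; exists g.
by apply/eqP; rewrite -tofrac_eq rmorphM rmorph1; apply/eqP.
Qed.

Lemma ringxy_regular :
  regular (@kconst K) (ringxy (K := K)) (tofrac (psx K)) (tofrac fpsX).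
Proof.
split.
- split; first by exists 1 => //; rewrite rmorph1.
    by move=> _ _ [f _ <-] [g _ <-]; exists (f - g) => //; rewrite rmorphB.
  by move=> _ _ [f _ <-] [g _ <-]; exists (f * g) => //; rewrite rmorphM.
- by move=> c; exists (fpsC (fpsC c)).
- move=> x; split=> [mx|].
    have [f _ fx] := maxidW mx; move: mx; rewrite -fx => /ringxy_maxid.
    rewrite psxy_unitE negbK => /eqP f0.
    (* The part of f free of y has no constant term, hence is a multiple of x; the rest of f is a
       multiple of y. *)
    exists (tofrac (fpsC (fps_shift (fcoef f 0)))), (tofrac (fps_shift f)).
    split; [by eexists|by eexists|].
    rewrite -!rmorphM -rmorphD; congr (tofrac _).
    rewrite [LHS]fps_shiftE; congr (fpsC _ + _).
    by rewrite [LHS]fps_shiftE f0 rmorph0 add0r.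
  move=> [_ [_ [[f _ <-] [g _ <-] ->]]]; rewrite -!rmorphM -rmorphD.
  apply/ringxy_maxid; rewrite psxy_unitE negbK fcoefD fcoefMX0 addr0 fcoefM0.
  by rewrite fcoefM0 /= mulr0.
- move=> _ [f _ <-]; exists (fcoef (fcoef f 0) 0).
  rewrite /kconst /= -rmorphB; apply/ringxy_maxid.
  by rewrite psxy_unitE negbK !(fcoefD, fcoefN) /= subrr.
split.
  rewrite tofrac_eq0; apply/eqP => /(congr1 (fun f => fcoef (fcoef f 0) 1)) /= /eqP.
  by rewrite oner_eq0.
move=> _ _ [f _ <-] [g _ <-] /eqP; rewrite -!rmorphM tofrac_eq => /eqP e.
(* Comparing powers of y in f y = g x: the coefficient of f in degree n is x times that of g in
   degree n + 1. *)
exists (tofrac (fps_shift g)); first by eexists.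
rewrite -rmorphM; congr (tofrac _); apply: fpsP => n.
by rewrite -(fcoefMXS f) e !fcoefMC.
Qed.

End BaseRing.

Theorem proposition2p1 (K : closedFieldType) (p : {psxy K}) (c : nat)
    (U : {psxy K}) (hP : special_pencil p c U)
    (S : set (set {fracxy K})) (hS : resolution (pencil_germ p c U) S)
    (V : set {fracxy K}) (hV : dicritical (pencil_germ p c U) S V) :
  exists (z : {fracxy K}) (Q : {poly K}),
    affine_coordinate (@kconst K) S V z /\
    maxid V (pencil_germ p c U - peval (@kconst K) Q z)%R.
Proof.
case: hP hS hV => _ uU _ _ [tS _] [compV ncV].
apply: (fibre_component_polynomial _ tS compV ncV).
(* The parameter x takes the role of v, so that r = (p / U) / x^c has the first shape. *)
exists (FracField.tofrac fpsX), (FracField.tofrac (psx K)).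
split; first exact: reg_sym (ringxy_regular K).
left; exists c, (FracField.tofrac (p / U)%R); split; first by eexists.
rewrite /pencil_germ !rmorphM rmorphV // rmorphXn invfM.
by rewrite -mulrA [(_^-1 * _^-1)%R]mulrC.
Qed.
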